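(* Let $(\Omega,\mathscr F,\mu)$ be a complete probability space, $\mathbf I$ a finite or countably infinite set, $Y$ a separable Banach space, and let $\mathscr G$ be a Bayesian game with strategy sets $X_i$, random payoff functions $u_i:\Omega\times X\to\mathbb R$, prior densities $q_i$ ($i\in\mathbf I$), and an information partition common to all players, where $X=\prod_{i\in\mathbf I}X_i$. Let $h_i:\Omega\times X\to\mathbb R$ be the conditional expected utility of player $i$ and set $$Q_i^{u_i}(\omega,x)=\{y_i\in X_i: h_i(\omega,y_i,x_{-i})-h_i(\omega,x)>0\},\qquad(\omega,x)\in\Omega\times X.$$ Assume that for each $i\in\mathbf I$: 1. $X_i$ is a nonempty, compact, convex subset of $Y$; 2. for each $\omega\in\Omega$ and each $x_{-i}\in X_{-i}=\prod_{j\neq i}X_j$ the function $x_i\mapsto u_i(\omega,x_i,x_{-i})$ is concave; 3. the correspondence $Q_i^{u_i}:\Omega\times X\to 2^{X_i}$ satisfies the continuous inclusion property if the measure space is atomic, and the strong continuous inclusion property otherwise; 4. either $Y$ is finite-dimensional or $\mathbb K(Q_i^{u_i})(\omega,x)\neq\emptyset$ for all $(\omega,x)\in U_{Q_i^{u_i}}$. Then $\mathscr G$ has a Bayesian equilibrium, i.e. there is a function $x^*:\Omega\to X$ such that each $x_i^*$ is $\mathscr F$-measurable and, for each $i\in\mathbf I$ and almost all $\omega\in\Omega$, $$h_i(\omega,x^*(\omega))=\max\{h_i(\omega,y_i,x^*_{-i}(\omega)):y_i\in X_i\}.$$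
   Context: Bayesian game: $X_i$ is the strategy set of player $i$; $u_i:\Omega\times X\to\mathbb R$ is the random payoff function; $q_i:\Omega\to(0,1]$ is measurable with $\int_\Omega q_i\,d\mu=1$ (prior density); the private information of each player is a measurable partition of $\Omega$ (into sets of $\mathscr F$), which is the same for all players. $\mathbf E(\omega)$ denotes the element of this common partition containing $\omega$, and it is assumed that $\int_{\mathbf E(\omega)}q_i\,d\mu>0$ for all $i\in\mathbf I$, $\omega\in\Omega$. The conditional expected utility is $$h_i(\omega,x)=\int_{\mathbf E(\omega)}q_i(t|\mathbf E(\omega))\,u_i(t,x)\,d\mu(t),\qquad q_i(t|\mathbf E(\omega))=\begin{cases}0,& t\notin\mathbf E(\omega),\\ \dfrac{q_i(t)}{\int_{\mathbf E(\omega)}q_i(s)\,d\mu(s)},& t\in\mathbf E(\omega),\end{cases}$$ these integrals being assumed to exist as real numbers. Notation: $2^Y$ is the power set of $Y$, $\mathrm{con}$ denotes convex hull, $\mathrm{int}$ denotes interior in $Y$, $\mathscr B(\cdot)$ denotes the Borel $\sigma$-algebra. A correspondence is a set-valued map, possibly with empty values. A finite measure space is atomic if it can be written as the union of countably many atoms. $X=\prod_i X_i$ carries the product topology (metrizable since $\mathbf I$ is countable). The definitions below are for correspondences $\Psi:T\times Z\to 2^Y$ with $(T,\mathscr T,\mu)$ a measure space, $Y$ a Banach space and $Z$ a metric space; they are applied with $T=\Omega$, $\mathscr T=\mathscr F$, $Z=X$, $\Psi=Q_i^{u_i}$ (regarded as taking values in $2^Y$). $U_\Psi=\{(t,x)\in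 T\times Z:\Psi(t,x)\ne\emptyset\}$, $U_\Psi^t=\{x\in Z:(t,x)\in U_\Psi\}$ for $t\in T$, and $U_\Psi^x=\{t\in T:(t,x)\in U_\Psi\}$ for $x\in Z$. A correspondence $\Phi$ between topological spaces $X_1$ and $Y_1$ is lower-semicontinuous (l.s.c.) if $\{x:\Phi(x)\cap V\neq\emptyset\}$ is open for every open $V\subseteq Y_1$; upper-semicontinuous (u.s.c.) if $\{x:\Phi(x)\subseteq V\}$ is open for every open $V\subseteq Y_1$; continuous if it is both. A correspondence $\Phi:T\times Z\to 2^Y$ is jointly lower measurable if $\{(t,x):\Phi(t,x)\cap V\ne\emptyset\}\in\mathscr T\otimes\mathscr B(Z)$ for every open $V\subseteq Y$ (and similarly for other target spaces). Continuous inclusion property: $\Psi$ has it if for each $z\in Z$ there is a correspondence $F_z:T\times Z\to 2^Y$ such that: (i) if $U_\Psi^z\neq\emptyset$, there is a collection $\{O_z^t:t\in U_\Psi^z\}$ of open neighbourhoods of $z$ in $Z$ with $F_z(t,x)\ne\emptyset$ and $F_z(t,x)\subseteq\Psi(t,x)$ for all $x\in O_z^t$ and all $t\in U_\Psi^z$; (ii) $\mathrm{con}F_z(t,\cdot):O_z^t\to 2^Y$ is l.s.c. for all $t\in U_\Psi^z$, and $\mathrm{con}F_z(t,\cdot):Z\to 2^Y$ is l.s.c. for all $t\notin U_\Psi^z$. Strong continuous inclusion property: $\Psi$ has it if there are correspondences $F_z:T\times Z\to 2^Y$ ($z\in Z$) and open neighbourhoods $O_z^t$ of $z$ in $Z$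 ($(t,z)\in U_\Psi$) such that $F_z(t,x)\neq\emptyset$ and $F_z(t,x)\subseteq\Psi(t,x)$ for all $x\in O_z^t$ and all $(t,z)\in U_\Psi$; for every $z\in Z$, $\mathrm{con}F_z(t,\cdot):O_z^t\to 2^Y$ is l.s.c. for all $t\in U_\Psi^z$ and $\mathrm{con}F_z(t,\cdot):Z\to 2^Y$ is l.s.c. for all $t\notin U_\Psi^z$; and, in addition, each $\mathrm{con}F_z:T\times Z\to 2^Y$ is jointly lower measurable and at least one of the following holds: (a) $F_y=F_z$ for all $y,z\in Z$; (b) the collections $\{F_z:z\in Z\}$ and $\{O_z^t:(t,z)\in U_\Psi\}$ are countable, and $\{(t,x):x\in O_z^t\}$ is $\mathscr T\otimes\mathscr B(Z)$-measurable for each $z\in Z$; (c) $U_\Psi\in\mathscr T\otimes\mathscr B(Z)$; the correspondence $\mathbb I:T\times Z\to 2^Z$, $\mathbb I(t,x)=\{z\in U_\Psi^t:x\in O_z^t\}$, is jointly lower measurable (has measurable graph) and is finite-valued; and for each fixed $(t,x)\in T\times Z$ the correspondence $H:Z\to 2^Y$, $H(z)=\mathrm{con}F_z(t,x)$, is continuous and satisfies $H(z)\subseteq B$ for all $z\in Z$ for some compact $B\subseteq Y$. With respect to the families $\{F_z\}$, $\{O_z^t\}$ witnessing the (strong) continuous inclusion property of $\Psi$, one sets $\mathbb K(\Psi)(t,x)=\bigcup\{\mathrm{int}F_z(t,x): x\in O_z^t \text{ and } \Psi(t,z)\neq\emptyset\}$. *)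

(* Defs.v *)
From HB Require Import structures.
From mathcomp Require Import all_boot all_order all_algebra.
From mathcomp Require Import all_classical all_reals all_analysis.

Set Implicit Arguments.
Unset Strict Implicit.
Unset Printing Implicit Defensive.

Import Order.TTheory GRing.Theory Num.Theory.
Import numFieldNormedType.Exports.

Local Open Scope classical_set_scope.
Local Open Scope ring_scope.

Definition separable (Y : topologicalType) : Prop :=
  exists2 D : set Y, countable D & dense D.

Definition finite_dimensional (R : realType) (Y : lmodType R) : Prop :=
  exists (n : nat) (b : 'I_n -> Y),
    forall y : Y, exists c : 'I_n -> R, y = \sum_(k < n) c k *: b k.

(* Convex hull; [smallest C A] is the intersection of all sets containing [A]
   that satisfy [C]. *)
Definition con (R : realType) (Y : lmodType R) (A : set Y) : set Y :=
  smallest (@convex_set R Y) A.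

(* [f] is only defined on the convex set [A], hence the convex combination is
   given as a point [c] of [A]. *)
Definition concave_on (R : realType) (Y : lmodType R) (A : set Y) (f : A -> R)
    : Prop :=
  forall (t : R) (a b c : A), 0 <= t <= 1 ->
    set_val c = t *: set_val a + (1 - t) *: set_val b ->
    t * f a + (1 - t) * f b <= f c.

Definition is_max (R : realType) (S : set R) (m : R) : Prop :=
  S m /\ ubound S m.

Section Atomic.
Context (d : measure_display) (T : measurableType d) (R : realType).
Variable mu : {measure set T -> \bar R}.

Definition atom (A : set T) : Prop :=
  [/\ measurable A, (0 < mu A)%E &
      forall B, measurable B -> B `<=` A -> mu B = 0%E \/ mu B = mu A].

Definition atomic : Prop :=
  exists As : set (set T),
    [/\ countable As, forall A, As A -> atom A & \bigcup_(A in As) A = setT].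

End Atomic.

(* Correspondences are set-valued functions; empty values are allowed. *)

Definition lsc_correspondence (X1 Y1 : topologicalType) (Phi : X1 -> set Y1)
    : Prop :=
  forall V : set Y1, open V -> open [set x | Phi x `&` V !=set0].

Definition usc_correspondence (X1 Y1 : topologicalType) (Phi : X1 -> set Y1)
    : Prop :=
  forall V : set Y1, open V -> open [set x | Phi x `<=` V].

Definition continuous_correspondence (X1 Y1 : topologicalType)
    (Phi : X1 -> set Y1) : Prop :=
  lsc_correspondence Phi /\ usc_correspondence Phi.

Section Correspondences.
Context (d : measure_display) (T : measurableType d) (Z : topologicalType).

(* The product of the given sigma-algebra of [T] with the Borel sigma-algebra
   of [Z], generated by the measurable rectangles.  The library's
   [measurableType] instance on a product is not used because it requires [Z]
   to be pointed. *)
Definition prod_borel : set (set (T * Z)) :=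
  <<s [set A `*` B | A in @measurable d T & B in <<s @open Z >>] >>.

Definition jointly_lower_measurable (W : topologicalType)
    (Phi : T -> Z -> set W) : Prop :=
  forall V : set W, open V ->
    prod_borel [set tx | Phi tx.1 tx.2 `&` V !=set0].

Context (R : realType) (Y : completeNormedModType R).

Definition dom (Psi : T -> Z -> set Y) : set (T * Z) :=
  [set tx | Psi tx.1 tx.2 !=set0].

Implicit Types (Psi : T -> Z -> set Y) (F : Z -> T -> Z -> set Y)
  (O : Z -> T -> set Z).

(* [F z] stands for F_z and [O z t] for O_z^t.  The value of [O z t] is
   irrelevant (and never used) when [(t, z)] is not in [dom Psi].  In the first
   semicontinuity clause the domain is the subtype of [Z] given by [O z t],
   with the subset topology. *)
Definition continuous_inclusion Psi F O : Prop :=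
  forall z : Z,
    [/\ forall t, dom Psi (t, z) ->
          [/\ open (O z t), O z t z &
              forall x, O z t x -> F z t x !=set0 /\ F z t x `<=` Psi t x],
        forall t, dom Psi (t, z) ->
          lsc_correspondence (fun x : O z t => con (F z t (set_val x))) &
        forall t, ~ dom Psi (t, z) ->
          lsc_correspondence (fun x : Z => con (F z t x))].

Definition nbhd_index Psi O (t : T) (x : Z) : set Z :=
  [set z | dom Psi (t, z) /\ O z t x].

Definition strong_condition_a F : Prop := forall y z : Z, F y = F z.

Definition strong_condition_b Psi F O : Prop :=
  [/\ countable (range F),
      countable [set O tz.2 tz.1 | tz in dom Psi] &
      forall z : Z,
        prod_borel [set tx | dom Psi (tx.1, z) /\ O z tx.1 tx.2]].

(* When [Z] is separable metrizable, a lower measurable correspondence with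
   finite values has a measurable graph, so the latter is not required
   separately. *)
Definition strong_condition_c Psi F O : Prop :=
  [/\ prod_borel (dom Psi),
      jointly_lower_measurable (nbhd_index Psi O),
      forall t x, finite_set (nbhd_index Psi O t x) &
      forall t x,
        continuous_correspondence (fun z : Z => con (F z t x)) /\
        exists2 B : set Y, compact B & forall z, con (F z t x) `<=` B].

Definition strong_continuous_inclusion Psi F O : Prop :=
  [/\ continuous_inclusion Psi F O,
      forall z, jointly_lower_measurable (fun t x => con (F z t x)) &
      [\/ strong_condition_a F, strong_condition_b Psi F O |
          strong_condition_c Psi F O]].

Definition KK Psi F O (t : T) (x : Z) : set Y :=
  \bigcup_(z in [set z | O z t x /\ Psi t z !=set0]) (F z t x)°.

End Correspondences.

(* The product of the strategy sets, with the product topology. *)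
Notation profile A := (prod_topology (fun i => set_type (A i))).

Section BayesianGames.
Context (d : measure_display) (Omega : measurableType d) (R : realType).
Variable mu : probability Omega R.

Definition prior_density (q : Omega -> R) : Prop :=
  [/\ forall w, 0 < q w <= 1, measurable_fun setT q & \int[mu]_w q w = 1].

Definition measurable_partition (P : set (set Omega)) : Prop :=
  partition P id setT /\ P `<=` measurable.

(* The element of the partition [P] that contains [w]. *)
Definition cell (P : set (set Omega)) (w : Omega) : set Omega :=
  pblock P id w.

Definition posterior (q : Omega -> R) (P : set (set Omega)) (w t : Omega) : R :=
  if t \in cell P w then q t / \int[mu]_(s in cell P w) q s else 0.

Context (I : countType) (Y : completeNormedModType R) (A : I -> set Y).

Definition cond_utility (q : Omega -> R) (P : set (set Omega))
    (u : Omega -> profile A -> R) (w : Omega) (x : profile A) : R :=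
  \int[mu]_(t in cell P w) (posterior q P w t * u t x).

(* [dfwith x i y] with [y : A i] is the profile (y, x_{-i}). *)
Definition improvement (i : I) (h : Omega -> profile A -> R) (w : Omega)
    (x : profile A) : set Y :=
  set_val @` [set y : A i | 0 < h w (dfwith x i y) - h w x].

(* Measurability is stated in [Y]; the Borel sigma-algebra of [A i] is the trace
   of that of [Y]. *)
Definition bayesian_equilibrium (h : I -> Omega -> profile A -> R)
    (x : Omega -> profile A) : Prop :=
  (forall i, measurable_fun setT
     (fun w => set_val (x w i) : g_sigma_algebraType (@open Y))) /\
  (forall i, {ae mu, forall w,
     is_max [set h i w (dfwith (x w) i y) | y in [set: A i]] (h i w (x w))}).

End BayesianGames.

(* Main.v *)
(** All players share one partition, whose cells have positive probability.  So there are countably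
    many cells, the conditional utilities are constant on each of them, and it is enough to choose,
    cell by cell, a Nash equilibrium of a game with complete information: measurability is automatic.

    Let [Q i x] be the set of improvements of player [i] at the profile [x], a convex set that does
    not contain [x i].  The inclusion property says that, wherever [Q i] has nonempty values, so has
    its largest lower semicontinuous part [core (Q i)], which is convex-valued as well.  If there were
    no equilibrium, finitely many of the open sets [{x | core (Q i) x !=set0}] would cover the compact
    set of profiles; shrinking them to closed sets and selecting continuously from [core (Q i)] on
    these gives a continuous map of profiles, and a fixed point of it is a profile with [x i] in
    [Q i x].

    The values of [core (Q i)] are not closed.  Michael's iteration yields countably many continuous
    selections of the closures that are dense in every value; their mean with weights [1/2, 1/4, ...]
    lies in the value itself as soon as the value has an interior point relative to a closed affine
    subspace containing it.  Condition 4 ensures this, by finite dimension or by an interior point.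

    Brouwer's theorem comes from Scarf's lemma on finite sets with several linear orders, whose proof
    is a parity count and needs no triangulation. *)
Require Import Defs.
From HB Require Import structures.
From mathcomp Require Import all_boot all_order all_algebra.
From mathcomp Require Import zify ring lra.

Set Implicit Arguments.
Unset Strict Implicit.
Unset Printing Implicit Defensive.

(** * Scarf's combinatorial lemma *)

Section Scarf.
Variables (I T : finType) (r : I -> T -> nat) (s : I -> T) (c : T -> I).

(** [r i] ranks the elements in the [i]-th linear order, the [s i] are slack elements and [c] is a
    colouring. Dominance forbids an element that, in every order, lies strictly above some member of
    [A]. *)
Definition dominant (A : {set T}) :=
  [forall y, exists i, forall x in A, r i y <= r i x].

Hypothesis r_inj : forall i, injective (r i).
Hypothesis I_gt1 : 1 < #|I|.
Hypothesis s_inj : injective s.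
Hypothesis s_min : forall i t, r i (s i) <= r i t.
Hypothesis s_max : forall i j t, t \notin codom s -> i != j -> r i t < r i (s j).
Hypothesis c_s : forall i, c (s i) = i.

Lemma dominantP (A : {set T}) :
  reflect (forall y, exists i, forall x, x \in A -> r i y <= r i x) (dominant A).
Proof.
apply: (iffP forallP) => H y; have := H y.
  by case/existsP=> i /forall_inP Hi; exists i.
by case=> i Hi; apply/existsP; exists i; apply/forall_inP.
Qed.

Lemma dominantS (A B : {set T}) : A \subset B -> dominant B -> dominant A.
Proof.
move=> /subsetP sAB /dominantP dB; apply/dominantP => y.
by have [i Hi] := dB y; exists i => x /sAB; exact: Hi.
Qed.

(* If a dominant set has one element less than there are orders, then exactly two of its minima
   [least i] coincide; an extension by a point is dominant if and only if the point is the top of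
   [above i] for one of these two [i]. *)
Section Door.
Variables (A : {set T}) (domA : dominant A) (cardA : #|A|.+1 = #|I|).

Variables (x0 : T) (x0A : x0 \in A).

Definition least i := [arg min_(x < x0 in A) r i x].

Lemma least_in i : least i \in A.
Proof. by rewrite /least; case: arg_minnP. Qed.

Lemma leastP i x : x \in A -> r i (least i) <= r i x.
Proof. by rewrite /least; case: arg_minnP => // y _ + xA; exact. Qed.

(** Dominance applied to the member [x] itself yields an order in which [x] is lowest. *)
Lemma leastE x : x \in A -> exists i, x = least i.
Proof.
move=> xA; have /dominantP/(_ x) [i Hi] := domA; exists i.
by apply: (r_inj (i := i)); apply/eqP; rewrite eqn_leq Hi ?least_in // leastP.
Qed.

Lemma least_image : least @: [set: I] = A.
Proof.
apply/setP => x; apply/imsetP/idP => [[i _ ->]|/leastE[i ->]]; first exact: least_in.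
by exists i.
Qed.

(** Pigeonhole: [least] maps the orders onto a set with one element less, so two orders share a
    minimum, and leaving out either of them makes [least] a bijection onto [A]. *)
Lemma least_collision :
  exists i j, [/\ i != j, least i = least j &
    forall a, a \in [set i; j] -> {in [set~ a] &, injective least} /\ least @: [set~ a] = A].
Proof.
have : ~~ [forall i, forall j, (least i == least j) ==> (i == j)].
  apply/negP => /forallP H.
  have inj : injective least.
    by move=> i j /eqP e; apply/eqP; move: (H i) => /forallP/(_ j)/implyP; apply.
  have := card_imset [set: I] inj; rewrite least_image cardsT; lia.
rewrite negb_forall => /existsP[i]; rewrite negb_forall => /existsP[j].
rewrite negb_imply => /andP[/eqP eij nij]; exists i, j; split=> // a.
have key (k l : I) : k != l -> least k = least l ->
    {in [set~ k] &, injective least} /\ least @: [set~ k] = A.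
  move=> kl ekl.
  have im : least @: [set~ k] = A.
    rewrite -least_image; apply/setP => x; apply/imsetP/imsetP => [[b _ ->]|[b _ ->]].
      by exists b.
    have [->|bk] := eqVneq b k; last by exists b; rewrite ?inE.
    by exists l; rewrite ?inE // eq_sym.
  by split=> //; apply/imset_injP; rewrite im cardsC1; lia.
by rewrite !inE => /orP[]/eqP->; [exact: (key _ _ nij eij)|apply: (key j i); rewrite // eq_sym].
Qed.

(** These points can join [A] without displacing its minimum in any order other than [a]. *)
Definition above a := [set y | [forall (l | l != a), r l (least l) < r l y]].

Lemma aboveP a y : reflect (forall l, l != a -> r l (least l) < r l y) (y \in above a).
Proof. by rewrite inE; apply: (iffP forall_inP). Qed.

Definition extension y := (y \notin A) && dominant (y |: A).

(** In a dominant extension every old member must remain the minimum in some order. Hence [y] takes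
    over the minimum in one order [a] only, and [a] must be one of the two orders that share a
    minimum. Dominance over the other points of [above a] then says that [y] is the highest of them
    in the order [a]. *)
Lemma extensionP i j y :
  i != j -> least i = least j ->
  (forall a, a \in [set i; j] -> {in [set~ a] &, injective least} /\ least @: [set~ a] = A) ->
  reflect (exists2 a, a \in [set i; j] &
     y \in above a /\ forall z, z \in above a -> r a z <= r a y) (extension y).
Proof.
move=> nij eij inj; apply: (iffP andP).
  case=> yA /dominantP dyA.
  have lower a : (forall x, x \in A -> r a y <= r a x) ->
      forall x, x \in A -> exists2 l, l != a & x = least l /\ r l x < r l y.
    move=> Ha x xA; have [l Hl] := dyA x.
    have xy : x != y by apply: contraNneq yA => <-.
    have Hxy : r l x < r l y.
      rewrite ltn_neqAle Hl ?setU11 // andbT; apply: contra xy => /eqP e.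
      by apply/eqP/(r_inj e).
    exists l; first by apply: contraTneq Hxy => ->; rewrite -leqNgt Ha.
    split=> //; apply: (r_inj (i := l)); apply/eqP.
    by rewrite eqn_leq Hl ?inE ?least_in ?orbT //= leastP.
  have [a Ha0] := dyA y.
  have Ha x : x \in A -> r a y <= r a x by move=> xA; apply: Ha0; rewrite inE xA orbT.
  have {}lower := lower a Ha.
  have sub : A = least @: [set~ a].
    apply/setP => x; apply/idP/imsetP => [/lower[l la [-> _]]|[l _ ->]]; last exact: least_in.
    by exists l; rewrite ?inE.
  have inja : {in [set~ a] &, injective least}.
    by apply/imset_injP; rewrite -sub cardsC1; lia.
  exists a.
    apply: contraT; rewrite !inE negb_or => /andP[ai aj].
    have /eqP : i = j by apply: inja; rewrite ?inE 1?eq_sym.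
    by rewrite (negPf nij).
  split.
    apply/aboveP => l la; have [l' l'a [e lt]] := lower _ (least_in l).
    suff -> : l = l' by rewrite -e.
    by apply: inja; rewrite ?inE.
  move=> z /aboveP za; have [l Hl] := dyA z.
  have : l == a.
    apply: contraT => /za; rewrite ltnNge Hl // inE least_in orbT //.
  by move/eqP<-; apply: Hl; rewrite setU11.
case=> a aij [/aboveP ya top].
have yA : y \notin A.
  apply/negP => yA; have [_ im] := inj a aij.
  by move: (yA); rewrite -im => /imsetP[l]; rewrite !inE => /ya + e; rewrite e ltnn.
split=> //; apply/dominantP => z.
have [za|/negP za] := boolP (z \in above a).
  exists a => x; rewrite !inE => /orP[/eqP->|xA]; first exact: top.
  apply: leq_trans (top _ za) _; apply: leq_trans (leastP a xA).
  have /dominantP/(_ y)[l Hl] := domA.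
  have : l == a by apply: contraT => /ya; rewrite ltnNge Hl // least_in.
  by move/eqP<-; rewrite Hl ?least_in.
have : ~~ [forall (l | l != a), r l (least l) < r l z] by move: za; rewrite inE => /negP.
rewrite negb_forall => /existsP[l]; rewrite negb_imply -leqNgt => /andP[la Hl].
exists l => x; rewrite !inE => /orP[/eqP->|xA].
  by apply: leq_trans Hl _; apply/ltnW/ya.
by apply: leq_trans Hl _; apply: leastP.
Qed.

Definition top a := [set y in above a | [forall z in above a, r a z <= r a y]].

Lemma card_top a : #|top a| = (above a != set0).
Proof.
case: (set_0Vmem (above a)) => [e|[y0 y0a]].
  by rewrite /top e eqxx; apply: eq_card0 => y; rewrite !inE.
have -> : above a != set0 by apply/set0Pn; exists y0.
apply/eqP/cards1P; case: (@arg_maxnP _ y0 [in above a] (r a) y0a) => y ya ymax.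
exists y; apply/setP => z; rewrite in_set1 inE; apply/andP/eqP => [[za /forall_inP zmax]|->].
  by apply: (r_inj (i := a)); apply/eqP; rewrite eqn_leq zmax // andbT; exact: ymax.
by split=> //; apply/forall_inP => w; apply: ymax.
Qed.

(** The tops of [above i] and [above j] are distinct: a common one would exceed the minimum of [A]
    in every order, against dominance. *)
Lemma card_extension i j :
  i != j -> least i = least j ->
  (forall a, a \in [set i; j] -> {in [set~ a] &, injective least} /\ least @: [set~ a] = A) ->
  #|[set y | extension y]| = (above i != set0) + (above j != set0).
Proof.
move=> nij eij inj; rewrite -!card_top -cardsUI.
have -> : top i :&: top j = set0.
  apply/setP => y; rewrite in_set0; apply/negbTE/negP => /setIP[].
  rewrite !inE => /andP[/forall_inP yi _] /andP[/forall_inP yj _].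
  have /dominantP/(_ y)[l Hl] := domA.
  have [li|] := eqVneq l i; last by move/yi; rewrite ltnNge Hl ?least_in.
  have : l != j by rewrite li.
  by move/yj; rewrite ltnNge Hl ?least_in.
rewrite cards0 addn0; apply: eq_card => y; rewrite inE.
apply/(extensionP y nij eij inj)/setUP.
  case=> a; rewrite in_set2 => /orP[]/eqP-> [ya /forall_inP yt]; [left|right];
    by apply/setIdP.
by case=> /setIdP[ya /forall_inP yt]; [exists i|exists j]; rewrite ?in_set2 ?eqxx ?orbT.
Qed.

End Door.

(** * Parity of incidences between rooms and doors *)

Section Parity.
Variable i0 : I.

(** The set sought is a room with all colours. Rooms are joined through doors, the smaller dominant
    sets that show every colour except [i0]. *)
Definition room S := dominant S && (#|S| == #|I|).
Definition door A := [&& dominant A, #|A|.+1 == #|I| & c @: A == [set~ i0]].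

Lemma card_door_rooms A : dominant A -> #|A|.+1 = #|I| ->
  #|[set S | room S & A \subset S]| = #|[set y | extension A y]|.
Proof.
move=> dA cA; rewrite -(card_in_imset (f := fun y => y |: A)).
  apply: eq_card => S; rewrite inE; apply/andP/imsetP.
    case=> /andP[dS /eqP cS] sAS.
    have : #|S :\: A| == 1 by rewrite cardsDS // cS -cA subSnn.
    case/cards1P => y Sy; have yS : y \in S :\: A by rewrite Sy set11.
    have eS : S = y |: A by rewrite -Sy -{1}(setID S A) (setIidPr sAS) setUC.
    exists y => //; move: yS; rewrite !inE => /andP[yA _].
    by rewrite /extension yA -eS.
  case=> y; rewrite inE => /andP[yA dyA] ->; split; last exact: subsetUr.
  by rewrite /room dyA cardsU1 yA add1n cA eqxx.
move=> y z; rewrite !inE => /andP[yA _] /andP[zA _] e.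
by have := setU11 y A; rewrite e !inE (negPf yA) orbF => /eqP.
Qed.

Lemma card_room_doors S : room S ->
  #|[set A | door A & A \subset S]| = #|[set x in S | c @: (S :\ x) == [set~ i0]]|.
Proof.
case/andP=> dS /eqP cS; rewrite -(card_in_imset (f := fun x => S :\ x)).
  apply: eq_card => A; rewrite inE; apply/andP/imsetP.
    case=> /and3P[dA /eqP cA cAi] sAS.
    have : #|S :\: A| == 1 by rewrite cardsDS // cS -cA subSnn.
    case/cards1P => x Sx; have xS : x \in S :\: A by rewrite Sx set11.
    have eA : A = S :\ x by rewrite -Sx setDDr setDv set0U (setIidPr sAS).
    by exists x => //; move: xS; rewrite !inE -eA cAi andbT => /andP[].
  case=> x; rewrite inE => /andP[xS cx] ->; split; last exact: subsetDl.
  rewrite /door cx andbT (dominantS (subsetDl _ _) dS) /=.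
  by have := cardsD1 x S; rewrite xS cS => ->.
move=> x y; rewrite !inE => /andP[xS _] /andP[yS _] e.
apply/eqP; apply: contraT => xy.
by have : x \in S :\ y; [rewrite !inE xy | rewrite -e !inE eqxx].
Qed.

(** A room with all colours has one door, left by removing its element of colour [i0]. Any other
    room has no door, or two, left by removing one of the two elements of equal colour. *)
Lemma odd_room_doors S : room S ->
  odd #|[set x in S | c @: (S :\ x) == [set~ i0]]| = (c @: S == [set: I]).
Proof.
move=> /andP[dS /eqP cS]; case: eqVneq => [e|ne].
  have injc : {in S &, injective c} by apply/imset_injP; rewrite e cardsT cS.
  have /imsetP[x xS xi0] : i0 \in c @: S by rewrite e.
  suff -> : [set x in S | c @: (S :\ x) == [set~ i0]] = [set x] by rewrite cards1.
  apply/setP => y; rewrite !inE; apply/andP/eqP => [[yS /eqP cy]|->].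
    apply/eqP; apply: contraT => yx; have : i0 \in c @: (S :\ y).
      by rewrite xi0 imset_f // !inE eq_sym yx.
    by rewrite cy !inE eqxx.
  split=> //; apply/eqP/setP => i; rewrite !inE; apply/imsetP/idP.
    case=> z; rewrite !inE => /andP[zx zS] ->; rewrite xi0.
    by apply: contra zx => /eqP /(injc _ _ zS xS) ->.
  move=> ii0; have /imsetP[z zS zi] : i \in c @: S by rewrite e.
  by exists z => //; rewrite !inE zS andbT; apply: contra ii0 => /eqP zx; rewrite zi zx xi0.
case: (set_0Vmem [set x in S | c @: (S :\ x) == [set~ i0]]) => [->|[x]].
  by rewrite cards0.
rewrite !inE => /andP[xS /eqP cx].
have cS' : #|S :\ x|.+1 = #|I| by have := cardsD1 x S; rewrite xS cS => ->.
have injx : {in S :\ x &, injective c}.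
  by apply/imset_injP; rewrite cx cardsC1; lia.
have /imsetP[x' x'S ex] : c x \in c @: (S :\ x).
  rewrite cx !inE; apply: contra ne => /eqP cxi.
  rewrite eqEsubset subsetT /=; apply/subsetP => i _.
  have [->|ii] := eqVneq i i0; first by rewrite -cxi imset_f.
  have : i \in c @: (S :\ x) by rewrite cx !inE.
  by case/imsetP=> z; rewrite !inE => /andP[_ zS] ->; rewrite imset_f.
move: (x'S); rewrite !inE => /andP[x'x x'S'].
suff -> : [set x in S | c @: (S :\ x) == [set~ i0]] = [set x; x'].
  by rewrite cards2 eq_sym x'x.
have cSe : c @: S = [set~ i0].
  by rewrite -(setD1K xS) imsetU1 cx ex -cx; apply/setUidPr; rewrite sub1set imset_f.
apply/setP => y; rewrite !inE; apply/andP/orP.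
  case=> yS /eqP cy; have [->|yx] := eqVneq y x; [by left|right].
  have injy : {in S :\ y &, injective c}.
    by apply/imset_injP; rewrite cy cardsC1; have := cardsD1 y S; rewrite yS cS; lia.
  apply: contraT => yx'; have /eqP : x = x'.
    by apply: injy ex; rewrite !inE eq_sym ?yx ?yx' ?xS ?x'S'.
  by rewrite eq_sym (negPf x'x).
case=> /eqP->; first by rewrite xS cx.
split=> //; apply/eqP; rewrite -cSe; apply/eqP.
rewrite eqEsubset imsetS ?subsetDl //=; apply/subsetP => i /imsetP[z zS ->].
have [->|zx'] := eqVneq z x'; last by rewrite imset_f // !inE zx'.
by rewrite -ex imset_f // !inE eq_sym x'x.
Qed.

Lemma slack_dominant : dominant (s @: [set~ i0]).
Proof.
apply/dominantP => y; have [/codomP[k ->]|ny] := boolP (y \in codom s).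
  by exists k => x _; exact: s_min.
exists i0 => x /imsetP[j]; rewrite !inE => ji ->.
by apply: ltnW; apply: s_max; rewrite // eq_sym.
Qed.

Lemma slack_door : door (s @: [set~ i0]).
Proof.
rewrite /door slack_dominant card_imset // cardsC1 prednK ?(ltnW I_gt1) // eqxx /=.
rewrite -imset_comp; apply/eqP/setP => i; apply/imsetP/idP => [[j ji ->] /=|ii].
  by rewrite c_s.
by exists i; rewrite //= c_s.
Qed.

(** The rooms around a door are counted by the nonempty sets among [above i] and [above j]. Both are
    nonempty, except for the door made of slack elements, which lies on the boundary and has a
    single room. *)
Lemma odd_door_rooms A : door A ->
  odd #|[set S | room S & A \subset S]| = (A == s @: [set~ i0]).
Proof.
move=> /and3P[dA /eqP cA /eqP cAi]; rewrite (card_door_rooms dA cA).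
have /card_gt0P[x0 x0A] : 0 < #|A| by lia.
have [i [j [nij eij inj]]] := least_collision dA cA x0A.
rewrite (card_extension dA cA x0A nij eij inj).
have [eA|neA] := eqVneq A (s @: [set~ i0]).
  have ls l : l != i0 -> least A x0 l = s l.
    move=> li; apply: (r_inj (i := l)); apply/eqP; rewrite eqn_leq s_min andbT.
    by apply: leastP => //; rewrite eA imset_f // !inE.
  have ab_i0 : above A x0 i0 != set0.
    apply/set0Pn; exists (s i0); apply/aboveP => l li; rewrite ls //.
    rewrite ltn_neqAle s_min andbT; apply: contra li => /eqP.
    by move/(r_inj (i := l))/s_inj => ->.
  (* A member of [above A x0 k] would exceed [s k] in the order [i0], so it would be slack; but
     [s i0] is lowest in that order, and any other [s l] fails to exceed itself. *)
  have ab_j k : k != i0 -> least A x0 i0 = s k -> above A x0 k = set0.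
    move=> ki lk; apply/setP => y; rewrite in_set0; apply/negbTE/negP => /aboveP ay.
    have := ay i0; rewrite eq_sym ki lk => /(_ isT).
    have [/codomP[l yl]|ny] := boolP (y \in codom s).
      rewrite yl; have [->|li] := eqVneq l i0; first by rewrite ltnNge s_min.
      have [->|lk'] := eqVneq l k; first by rewrite ltnn.
      by have := ay l lk'; rewrite yl ls // ltnn.
    by rewrite ltnNge ltnW // s_max // eq_sym.
  have i0ij : i0 \in [set i; j].
    apply: contraT; rewrite !inE negb_or ![i0 == _]eq_sym => /andP[ii ji].
    by move: eij; rewrite !ls // => /s_inj /eqP; rewrite (negPf nij).
  move: i0ij eij nij; rewrite !inE => /orP[]/eqP<- eij nij; rewrite ab_i0.
    by rewrite ab_j ?eqxx // 1?eq_sym // eij ls // eq_sym.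
  by rewrite ab_j ?eqxx // -eij ls.
have [x xA nx] : exists2 x, x \in A & x \notin codom s.
  apply/exists_inP; apply: contraT; rewrite negb_exists_in => /forall_inP H.
  suff : A == s @: [set~ i0] by rewrite (negPf neA).
  rewrite eqEcard card_imset // cardsC1 -cA /= leqnn andbT.
  apply/subsetP => x xA; have := H x xA; rewrite negbK => /codomP[k e].
  by rewrite e imset_f // -cAi -(c_s k) -e imset_f.
(* The element [x] of [A] is not slack, so in each order other than [k] it lies below [s k], and so
   does the minimum. *)
have ab k : above A x0 k != set0.
  apply/set0Pn; exists (s k); apply/aboveP => l lk.
  by apply: leq_ltn_trans (leastP x0A l xA) _; exact: s_max.
by rewrite !ab.
Qed.

(** Pairs of a room and a door inside it are counted in two ways. By doors the count is odd, since
    only the slack door contributes an odd number; by rooms it has the parity of the number of rooms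
    with all colours. *)
Lemma scarf_i0 : exists S, [/\ dominant S, #|S| = #|I| & c @: S = [set: I]].
Proof.
have count : \sum_(S | room S) #|[set A | door A & A \subset S]|
     = \sum_(A | door A) #|[set S | room S & A \subset S]|.
  have card_sum (Q B : pred {set T}) : #|[set A | Q A & B A]| = \sum_(A | Q A) B A.
    by rewrite -sum1dep_card big_mkcondr; apply: eq_bigr => A _; case: (B A).
  under eq_bigr => S _ do rewrite (card_sum door (fun A => A \subset S)).
  rewrite exchange_big /=; apply: eq_bigr => A dA.
  by rewrite (card_sum room (fun S => A \subset S)).
have odd_sum (J : finType) (Q : pred J) (F : J -> nat) :
    odd (\sum_(k | Q k) F k) = odd (\sum_(k | Q k) odd (F k)).
  by elim/big_rec2: _ => // k m n _ e; rewrite !oddD oddb e.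
have : odd (\sum_(S | room S) (c @: S == [set: I])).
  rewrite -(eq_bigr _ (fun S rS => congr1 nat_of_bool (odd_room_doors rS))).
  under eq_bigr => S rS do rewrite -card_room_doors //.
  rewrite -odd_sum count odd_sum.
  under eq_bigr => A dA do rewrite odd_door_rooms //.
  rewrite (bigD1 _ slack_door) eqxx /= big1 // => A /andP[_ /negPf->] //.
case: (boolP [exists (S | room S), c @: S == [set: I]]) => [|/exists_inPn H].
  by case/exists_inP=> S /andP[dS /eqP cS] /eqP e; exists S.
by rewrite big1 // => S rS; rewrite (negPf (H S rS)).
Qed.

End Parity.

Lemma scarf : exists S, [/\ dominant S, #|S| = #|I| & c @: S = [set: I]].
Proof.
have /card_gt0P[i0 _] : 0 < #|I| by lia.
exact: scarf_i0 i0.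
Qed.

End Scarf.

(** * Scarf's lemma for the grid points of a simplex *)

Section Grid.
Variables (K N : nat).
Hypothesis K_gt1 : 1 < K.

(** The points of the simplex whose coordinates are multiples of [1/N], scaled by [N]. *)
Definition grid := {x : {ffun 'I_K -> 'I_N.+1} | \sum_i x i == N}.

Definition grid_coord (x : grid) (i : 'I_K) : nat := val x i.

Lemma sum_grid_coord x : \sum_i grid_coord x i = N.
Proof. exact: (eqP (valP x)). Qed.

Lemma grid_mk (v : 'I_K -> nat) : \sum_i v i = N -> exists x, grid_coord x =1 v.
Proof.
move=> sv; have vN i : v i < N.+1 by rewrite ltnS -sv (bigD1 i) //= leq_addr.
pose x := [ffun i => Ordinal (vN i)].
have sx : \sum_i x i == N by under eq_bigr do rewrite ffunE; rewrite sv.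
by exists (exist _ x sx) => i; rewrite /grid_coord /= ffunE.
Qed.

Definition grid_size := #|{: grid}|.

Definition grid_index (x : grid) : nat := enum_rank x.

Lemma grid_index_lt x : grid_index x < grid_size.
Proof. exact: ltn_ord. Qed.

Lemma grid_index_inj : injective grid_index.
Proof. by move=> x y /val_inj/enum_rank_inj. Qed.

(** Grid points are compared by their [i]-th coordinate, ties being broken by the enumeration. The
    slack element [i] is at the bottom, the other slack elements are above the whole grid. *)
Definition grid_rank (i : 'I_K) (t : 'I_K + grid) : nat :=
  match t with
  | inl j => if j == i then 0 else (N.+1 * grid_size + j).+1
  | inr x => (grid_coord x i * grid_size + grid_index x).+1
  end.

Lemma grid_rank_lt i x : grid_rank i (inr x) < (N.+1 * grid_size).+1.
Proof.
rewrite /= ltnS mulSn; have := grid_index_lt x.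
have : grid_coord x i * grid_size <= N * grid_size.
  by rewrite leq_mul2r /grid_coord -ltnS ltn_ord orbT.
lia.
Qed.

Lemma grid_rank_le i x y : grid_rank i (inr x) <= grid_rank i (inr y) ->
  grid_coord x i <= grid_coord y i.
Proof.
rewrite /= ltnS => e; rewrite leqNgt; apply/negP => /(leq_mul (leqnn grid_size)).
by rewrite mulnS ![grid_size * _]mulnC; have := grid_index_lt y; lia.
Qed.

Lemma grid_rank_inj i : injective (grid_rank i).
Proof.
move=> [j|x] [k|y]; last first.
- move=> e; have := @grid_rank_le i x y; have := @grid_rank_le i y x.
  rewrite e leqnn => /(_ isT) h /(_ isT) h'; move: e => /= [].
  have -> : grid_coord x i = grid_coord y i by lia.
  by move/addnI/grid_index_inj->.
- move=> e; have := grid_rank_lt i x; have : 0 < grid_rank i (inr x) by [].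
  by rewrite e /=; case: eqP => // _; lia.
- move=> e; have := grid_rank_lt i y; have : 0 < grid_rank i (inr y) by [].
  by rewrite -e /=; case: eqP => // _; lia.
rewrite /=; case: eqP => [->|_]; case: eqP => [->|_] // [] /addnI e.
by congr inl; apply: val_inj.
Qed.

(* The slack elements [inl i] stand for the faces of the simplex, so no boundary condition is
   required from the colouring. *)
Lemma scarf_grid (c : grid -> 'I_K) : exists x : grid, forall i,
  grid_coord x i < K \/
  exists2 x', c x' = i & forall l, grid_coord x' l < grid_coord x l + K /\
                                   grid_coord x l < grid_coord x' l + K.
Proof.
pose c' (t : 'I_K + grid) := match t with inl i => i | inr x => c x end.
have [||||||S [/dominantP dS cS imS]] := @scarf 'I_K ('I_K + grid)%type grid_rank inl c'.
- exact: grid_rank_inj.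
- by rewrite card_ord.
- by move=> i j [].
- by move=> i t /=; rewrite eqxx.
- move=> i j [k|x]; first by rewrite codom_f.
  move=> _ ij; apply: leq_trans (grid_rank_lt i x) _ => /=.
  by rewrite eq_sym (negPf ij) ltnS leq_addr.
- by [].
(* These are the colours that only grid points of [S] can supply. Outside [C] the coordinate bound
   [b] below is set to zero. *)
pose C := [set i | inl i \notin S].
have colour i : i \in C -> exists2 x, inr x \in S & c x = i.
  rewrite inE => iS; have /imsetP[[j|x] tS ij] : i \in c' @: S by rewrite imS.
    by move: iS; rewrite ij /= tS.
  by exists x.
have below y : exists2 i, i \in C &
    forall x, inr x \in S -> grid_coord y i <= grid_coord x i.
  have [i Hi] := dS (inr y); exists i => [|x /Hi]; last exact: grid_rank_le.
  by rewrite inE; apply/negP => /Hi /=; rewrite eqxx.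
pose i00 : 'I_K := Ordinal (ltnW K_gt1).
have [y0 _] : exists y, grid_coord y =1 (fun i => if i == i00 then N else 0).
  by apply: grid_mk; rewrite -big_mkcond /= big_pred1_eq.
have [i0 i0C _] := below y0; have [x0 x0S _] := colour i0 i0C.
pose m i := grid_coord [arg min_(x < x0 | inr x \in S) grid_coord x i] i.
pose b i := if i \in C then m i else 0.
have mE i : exists2 x, inr x \in S & m i = grid_coord x i.
  by rewrite /m; case: arg_minnP => // x xS _; exists x.
have b_le i x : inr x \in S -> b i <= grid_coord x i.
  rewrite /b; case: ifP => // _ xS; rewrite /m.
  by case: arg_minnP => // z _ + ; apply.
have sum_b : N < \sum_i b i + K.
  rewrite ltnNge; apply/negP => le_N.
  (* If the bounds left room for it, raising each by one and giving the remainder to [i0] would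
     produce a grid point above every minimum, against dominance. *)
  pose v i := (b i).+1 + (if i == i0 then N - (\sum_i b i + K) else 0).
  have [y Hy] : exists y, grid_coord y =1 v.
    apply: grid_mk; rewrite /v big_split /= -big_mkcond /= big_pred1_eq.
    under eq_bigr do rewrite -addn1.
    by rewrite big_split /= sum1_card card_ord subnKC.
  have [i iC Hi] := below y; have [x xS mx] := mE i.
  by have := Hi x xS; rewrite Hy /v /b iC mx; lia.
(* All coordinates are at least their bounds and sum to [N], so none can exceed its bound by [K] or
   more. Hence the grid points of [S] are close to each other. *)
have lt_b i x : inr x \in S -> grid_coord x i < b i + K.
  move=> xS; have : \sum_j grid_coord x j < \sum_j b j + K by rewrite sum_grid_coord.
  rewrite (bigD1 i) //= [\sum_j b j](bigD1 i) //=.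
  have : \sum_(j | j != i) b j <= \sum_(j | j != i) grid_coord x j.
    by apply: leq_sum => j _; apply: b_le.
  have arith (p q X B : nat) : B <= X -> p + X < q + B + K -> p < q + K by lia.
  exact: arith.
exists x0 => i; have [iC|iC] := boolP (i \in C).
  right; have [x xS cx] := colour i iC; exists x => // l.
  have := lt_b l x xS; have := lt_b l x0 x0S; have := b_le l x xS; have := b_le l x0 x0S.
  by lia.
by left; have := lt_b i x0 x0S; rewrite /b (negPf iC).
Qed.

End Grid.

(* Imported only now, since [classical_sets] shadows the names of [finset]. *)
From mathcomp Require Import all_classical all_reals all_analysis.
From mathcomp Require Import measurable_realfun.

Import Order.TTheory GRing.Theory Num.Theory.
Import numFieldNormedType.Exports.

Local Open Scope classical_set_scope.
Local Open Scope ring_scope.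

(** * Brouwer's theorem on the simplex *)

Lemma continuous_sum (R : realType) (V : normedModType R) (X : topologicalType) (J : Type)
    (s : seq J) (P : pred J) (f : J -> X -> V) :
  (forall j, continuous (f j)) -> continuous (fun x => \sum_(j <- s | P j) f j x).
Proof.
move=> fC x; apply: (@cvg_big _ _ _ _ _ add_continuous _ (nbhs x) _ _ _ (nbhs_filter x)).
by move=> j _; exact: fC.
Qed.

Definition simplex (R : realType) (K : nat) : set 'rV[R]_K :=
  [set p | (forall i, 0 <= p ord0 i) /\ \sum_i p ord0 i = 1].

Lemma compact_simplex (R : realType) K : compact (@simplex R K).
Proof.
have cube : compact [set v : 'rV[R]_K | forall i, `[0, 1]%classic (v ord0 i)].
  by apply: (@rV_compact R K (fun=> `[0, 1]%classic)) => _; exact: segment_compact.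
apply: subclosed_compact cube _; last first.
  move=> p [p0 p1] i /=; rewrite in_itv /= p0 -p1 (bigD1 i) //= lerDl.
  exact: sumr_ge0.
rewrite (_ : @simplex R K = \bigcap_i [set p | 0 <= p ord0 i] `&`
    [set p | \sum_i p ord0 i = 1]); last first.
  by apply/seteqP; split => p [p0 p1]; split=> //= i; [move=> _|]; exact: p0.
have coordC i : continuous (fun p : 'rV[R]_K => p ord0 i) by exact: coord_continuous.
apply: closedI.
  apply: closed_bigI => i _.
  apply: (@preimage_closed _ _ (fun p : 'rV[R]_K => p ord0 i) [set x | 0 <= x]).
    by move=> p _; exact: coordC.
  exact: closed_ge.
pose total (p : 'rV[R]_K) := \sum_i p ord0 i.
apply: (@preimage_closed _ _ total [set x | x = 1]); last first.
  exact: closed_eq.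
move=> p _; apply: continuous_sum => i ?; exact: coordC.
Qed.

(** A grid point is coloured by a coordinate that [f] does not lower; there is one because both
    points have coordinate sum one. [scarf_grid] then gives a small cluster with every colour, up to
    coordinates close to zero. *)
Lemma brouwer_approx (R : realType) K (f : 'rV[R]_K -> 'rV[R]_K) (N : nat) :
  (1 < K)%N -> (0 < N)%N -> (forall p, simplex p -> simplex (f p)) ->
  exists2 p, simplex p & forall i, p ord0 i < K%:R / N%:R \/
    exists p', [/\ simplex p', p' ord0 i <= f p' ord0 i &
                   forall l, `|p ord0 l - p' ord0 l| <= K%:R / N%:R].
Proof.
move=> K1 N0 fS; have NR : 0 < N%:R :> R by rewrite ltr0n.
pose pt (x : grid K N) : 'rV[R]_K := \row_i ((grid_coord x i)%:R / N%:R).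
have ptS x : simplex (pt x).
  split=> [i|]; first by rewrite mxE divr_ge0.
  under eq_bigr do rewrite mxE.
  by rewrite -mulr_suml -natr_sum sum_grid_coord divff // gt_eqF.
have /choice[c cP] : forall x, exists i, pt x ord0 i <= f (pt x) ord0 i.
  move=> x; apply: contrapT => /forallNP H.
  have [_ s1] := ptS x; have [_ s2] := fS _ (ptS x).
  suff : \sum_i f (pt x) ord0 i < \sum_i pt x ord0 i by rewrite s1 s2 ltxx.
  apply: ltr_sum => [|i _]; first by apply/hasP; exists (Ordinal (ltnW K1)); rewrite ?mem_index_enum.
  by rewrite ltNge; exact/negP.
have [x Hx] := scarf_grid K1 c; exists (pt x) => // i.
have [lt|[x' cx' close]] := Hx i; first by left; rewrite mxE ltr_pM2r ?invr_gt0 // ltr_nat.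
right; exists (pt x'); split=> // [|l]; first by rewrite -cx'.
have [/ltnW h1 /ltnW h2] := close l.
rewrite !mxE -mulrBl normrM (gtr0_norm (x := N%:R^-1)) ?invr_gt0 //.
rewrite ler_pM2r ?invr_gt0 // ler_norml; move: h1 h2; rewrite -!(ler_nat R) !natrD; lra.
Qed.

(** At a cluster point [q] of the approximate solutions no coordinate is lowered by [f]: either the
    coordinate is small while that of [f q] is nonnegative, or a nearby [p'] does not have it
    lowered. As both coordinate sums are one, [f q = q]. *)
Lemma brouwer_simplex (R : realType) K (f : 'rV[R]_K -> 'rV[R]_K) :
  (0 < K)%N -> (forall p, simplex p -> simplex (f p)) ->
  (forall p i, simplex p ->
     f q ord0 i @[q --> within (@simplex R K) (nbhs p)] --> f p ord0 i) ->
  exists2 p, simplex p & f p = p.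
Proof.
(* Scarf's lemma is stated for at least two orders; with a single coordinate the simplex is a
   point. *)
move=> K0 fS fC; have [K1|] := ltnP 1 K; last first.
  move=> K1; have {K0 K1} eK : K = 1%N by apply/eqP; rewrite eqn_leq K1.
  subst K; have oneS : simplex (const_mx 1 : 'rV[R]_1).
    by split=> [i|]; rewrite ?big_ord1 !mxE.
  exists (const_mx 1) => //; apply/rowP => i; rewrite !ord1 mxE.
  by have [_] := fS _ oneS; rewrite big_ord1.
have /choice[p pP] : forall N, exists p, simplex p /\ forall i, p ord0 i < K%:R / N.+1%:R \/
    exists p', [/\ simplex p', p' ord0 i <= f p' ord0 i &
                   forall l, `|p ord0 l - p' ord0 l| <= K%:R / N.+1%:R].
  by move=> N; have [p] := @brouwer_approx R K f N.+1 K1 isT fS; exists p.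
have [|q [qS qC]] := @compact_simplex R K (p @ \oo) _.
  by exists 0%N => // n _; exact: (pP n).1.
exists q => //.
have KN (e : R) : 0 < e -> \forall n \near \oo, K%:R / n.+1%:R < e.
  move=> e0; have := near_infty_natSinv_lt (PosNum (divr_gt0 e0 (ltr0Sn R K))).
  apply: filterS => n /=; rewrite ltr_pdivlMr ?ltr0Sn // => h.
  apply: le_lt_trans h; rewrite mulrC ler_pM2l ?invr_gt0 ?ltr0Sn // ler_nat; exact: leqnSn.
have le_f i : q ord0 i <= f q ord0 i.
  rewrite leNgt; apply/negP => lt_f.
  pose e := (q ord0 i - f q ord0 i) / 2.
  have e0 : 0 < e by rewrite divr_gt0 // subr_gt0.
  have eE : q ord0 i = f q ord0 i + 2 * e by rewrite /e; field.
  clearbody e.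
  have [fq0 _] := fS q qS; have := fq0 i => fqi.
  have /cvgrPdist_lt/(_ _ e0) := fC q i qS.
  rewrite near_withinE => /nbhs_ballP[r /= r0 Hr].
  (* Half of the radius covers the distance from [q] to [p n], the other half that from [p n] to
     [p']. *)
  pose d := Num.min r e / 2.
  have d0 : 0 < d by rewrite divr_gt0 // lt_min r0 e0.
  have [dr de] : d <= r / 2 /\ d <= e / 2.
    by rewrite /d !ler_pM2r ?invr_gt0 // !ge_min !lexx orbT.
  clearbody d; have [N0 _ HN0] := KN d d0.
  have [] := qC [set p n | n in [set n | (N0 <= n)%N]] (ball q d).
  - by exists N0 => // n Hn; exists n.
  - exact: nbhsx_ballx.
  move=> _ [[n /HN0 /= nd <-]] qn.
  have qnl l : `|q ord0 l - p n ord0 l| < d by have [] := qn; move=> _; exact.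
  have := qnl i; rewrite ltr_norml => /andP[qn1 qn2].
  have [_ /(_ i)] := pP n; move: nd; set b := K%:R / _ => nd.
  move=> [lt|[p' [p'S le_p' close]]]; first by lra.
  have : ball q r p'.
    split=> // j l; rewrite ord1 /ball /=; have := close l; have := qnl l.
    by rewrite !ler_norml !ltr_norml => /andP[? ?] /andP[? ?]; apply/andP; split; lra.
  move/Hr => /(_ p'S) /=; rewrite ltr_norml => /andP[h1 h2].
  have := close i; rewrite ler_norml => /andP[h3 h4].
  by lra.
apply/rowP => i; apply/eqP; rewrite eq_le le_f andbT leNgt; apply/negP => lt_f.
have [_ s1] := qS; have [_ s2] := fS q qS.
suff : \sum_i q ord0 i < \sum_i f q ord0 i by rewrite s1 s2 ltxx.
rewrite (bigD1 i) //= [ltRHS](bigD1 i) //=; apply: ltr_leD => //.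
by apply: ler_sum.
Qed.

(** * Fixed points in products of compact convex sets *)

(** Compactness in its near-covering form is applied to the filter of finite lists ordered by
    inclusion, which gives one list that serves all points. *)
Lemma compact_subcover (X : topologicalType) (G : X -> set X) :
  compact [set: X] -> (forall x, open (G x)) -> (forall x, G x x) ->
  exists s : seq X, forall x, exists2 z, z \in s & G z x.
Proof.
move=> /compact_near_coveringP cX oG Gx.
pose F := filter_from [set: seq X] (fun D => [set E : seq X | {subset D <= E}]).
have FF : ProperFilter F.
  apply: filter_from_proper; last by move=> D _; exists D.
  apply: filter_from_filter; first by exists [::].
  move=> D E _ _; exists (D ++ E) => // S DES.
  by split=> x xD; apply: DES; rewrite mem_cat xD ?orbT.
have [|D _ HD] := cX _ F (fun E x => exists2 z, z \in E & G z x) _.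
  move=> x _; exists (G x, [set E : seq X | x \in E]) => /=.
    split; first exact: open_nbhs_nbhs.
    by exists [:: x] => // E; apply; rewrite mem_head.
  by move=> [x' E] /= [Gx' xE]; exists x.
by exists D => x; apply: HD.
Qed.

Section BumpBase.
Context (R : realType) (X : topologicalType) (C : Type).

(** The sets where some [b k] is positive form a base of the topology. Such a family takes the place
    of a metric, and it can be countable. *)
Definition bump_base (b : C -> X -> R) :=
  (forall k, continuous (b k)) /\
  forall G x, open G -> G x -> exists2 k, 0 < b k x & forall x', 0 < b k x' -> G x'.

Definition weights n (w : 'I_n -> X -> R) :=
  [/\ forall k, continuous (w k), forall k x, 0 <= w k x & forall x, \sum_k w k x = 1].

Lemma partition_of_unity (b : C -> X -> R) (G : X -> set X) :
  compact [set: X] -> bump_base b ->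
  (forall x, open (G x)) -> (forall x, G x x) ->
  exists n (z : 'I_n -> X) w, weights w /\ forall k x, 0 < w k x -> G (z k) x.
Proof.
move=> cX [bC bB] oG Gx.
have /choice[c cP] : forall x, exists k, 0 < b k x /\ forall x', 0 < b k x' -> G x x'.
  by move=> x; have [k] := bB (G x) x (oG x) (Gx x); exists k.
have [x|x|s sP] := @compact_subcover X (fun x => [set x' | 0 < b (c x) x']) cX.
- apply: (@open_comp _ _ (b (c x)) [set r | 0 < r]); last exact: open_gt.
  by move=> y _; exact: bC.
- exact: (cP x).1.
pose a (k : 'I_(size s)) x := Num.max 0 (b (c (tnth (in_tuple s) k)) x).
have a0 k x : 0 <= a k x by rewrite le_max lexx.
have aS x : 0 < \sum_k a k x.
  have [z /(tnthP (in_tuple s))[k ->] bz] := sP x.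
  by rewrite (bigD1 k) //= ltr_pwDl ?sumr_ge0 // lt_max bz orbT.
exists (size s), (tnth (in_tuple s)), (fun k x => a k x / \sum_j a j x); split; last first.
  move=> k x; rewrite pmulr_lgt0 ?invr_gt0 // lt_max ltxx /=; exact: (cP _).2.
have aC k : continuous (a k).
  move=> x; apply: (@continuous_max _ _ (fun=> 0)); [exact: cvg_cst|exact: bC].
split=> [k x|k x|x]; last by rewrite -mulr_suml divff // gt_eqF.
  apply: cvgM; first exact: aC.
  apply: cvgV; first by rewrite gt_eqF.
  by apply: continuous_sum => i ?; exact: aC.
by rewrite divr_ge0 // ltW.
Qed.

End BumpBase.

Lemma convex_setP (R : realType) (Y : lmodType R) (C : set Y) :
  convex_set C <-> forall (a b : Y) (t : R), 0 <= t <= 1 -> C a -> C b ->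
    C (t *: a + (1 - t) *: b).
Proof.
split=> [cC a b t /andP[t0 t1] Ca Cb|H x y l /set_mem Cx /set_mem Cy].
  have := cC a b (Itv01 t0 t1) (mem_set Ca) (mem_set Cb).
  by move/set_mem.
by apply/mem_set; apply: H => //; rewrite ge0 le1.
Qed.

Lemma convex_sum (R : realType) (Y : lmodType R) (C : set Y) n (p : 'I_n -> R)
    (y : 'I_n -> Y) :
  convex_set C -> (forall k, 0 <= p k) -> \sum_k p k = 1 ->
  (forall k, 0 < p k -> C (y k)) -> C (\sum_k p k *: y k).
Proof.
move=> /convex_setP cC; elim: n p y => [|n IH] p y p0 p1 Cy.
  by move: p1; rewrite big_ord0 => /eqP; rewrite eq_sym oner_eq0.
rewrite big_ord_recl; move: p1; rewrite big_ord_recl.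
set S := \sum_(k < n) p (lift ord0 k) => p1.
have S0 : 0 <= S by apply: sumr_ge0.
have [S_eq0|S_neq0] := eqVneq S 0.
  have z k : p (lift ord0 k) = 0.
    by apply: (psumr_eq0P _ S_eq0).
  rewrite big1 ?addr0 => [|k _]; last by rewrite z scale0r.
  have p01 : p ord0 = 1 by rewrite -p1 S_eq0 addr0.
  by rewrite p01 scale1r; apply: Cy; rewrite p01.
have Sp : 0 < S by rewrite lt_def S_neq0.
have Crest : C (\sum_(k < n) (p (lift ord0 k) / S) *: y (lift ord0 k)).
  apply: IH => [k||k]; first by rewrite divr_ge0.
    by rewrite -mulr_suml divff.
  by rewrite pmulr_lgt0 ?invr_gt0 //; apply: Cy.
have -> : \sum_(k < n) p (lift ord0 k) *: y (lift ord0 k) =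
    S *: \sum_(k < n) (p (lift ord0 k) / S) *: y (lift ord0 k).
  by rewrite scaler_sumr; apply: eq_bigr => k _; rewrite scalerA mulrCA divff // mulr1.
have [p00|p00] := eqVneq (p ord0) 0.
  have S1 : S = 1 by rewrite -p1 p00 add0r.
  by rewrite p00 scale0r add0r {1}S1 scale1r.
rewrite (_ : S *: _ = (1 - p ord0) *: \sum_(k < n) (p (lift ord0 k) / S) *: y (lift ord0 k)).
  apply: cC => //; last by apply: Cy; rewrite lt_def p00 p0.
  by rewrite p0 -p1 lerDl.
by rewrite -p1 addrC addKr.
Qed.

Lemma filter_forall_seq (T : Type) (F : set_system T) (J : eqType) (s : seq J)
    (Q : J -> T -> Prop) : Filter F ->
  (forall j, j \in s -> \forall t \near F, Q j t) ->
  \forall t \near F, forall j, j \in s -> Q j t.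
Proof.
move=> FF; elim: s => [|j s IH] H; first by apply: filterE => t j; rewrite in_nil.
have Qj : \forall t \near F, Q j t by apply: H; rewrite mem_head.
have Qs : \forall t \near F, forall k, k \in s -> Q k t.
  by apply: IH => k ks; apply: H; rewrite inE ks orbT.
apply: filterS2 Qj Qs => t Qjt Qst k; rewrite inE => /orP[/eqP->//|]; exact: Qst.
Qed.

Section ProductFixedPoint.
Context (R : realType) (X : topologicalType) (I : eqType) (Y : normedModType R).
Context (A : I -> set Y) (prj : I -> X -> Y) (C : Type) (b : C -> X -> R).
Hypothesis X_compact : compact [set: X].
Hypothesis A_convex : forall i, @convex_set R Y (A i).
Hypothesis prj_continuous : forall i, continuous (prj i).
Hypothesis prj_nbhs : forall G x, open G -> G x -> exists s : seq I, exists2 e : R,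
  0 < e & forall x', (forall i, i \in s -> `|prj i x - prj i x'| < e) -> G x'.
Hypothesis prj_in : forall i x, A i (prj i x).
Hypothesis prj_surj : forall y, (forall i, A i (y i)) -> exists x, forall i, prj i x = y i.
Hypothesis b_base : bump_base b.

(** Brouwer's theorem for the map that sends a coefficient vector [p] to the weights at the
    combination of the [z k] with coefficients [p]. *)
Lemma fixed_combination n (z : 'I_n -> X) (w : 'I_n -> X -> R) :
  X -> weights w -> exists x, forall i, prj i x = \sum_k w k x *: prj i (z k).
Proof.
move=> x0 [wC w0 w1].
have n0 : (0 < n)%N.
  case: n z w wC w0 w1 => // z w _ _ /(_ x0); rewrite big_ord0 => /eqP.
  by rewrite eq_sym oner_eq0.
(* Off the simplex [g] is arbitrary, so continuity is claimed only within it. *)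
have /choice[g gP] : forall p : 'rV[R]_n, exists x, simplex p ->
    forall i, prj i x = \sum_k p ord0 k *: prj i (z k).
  move=> p; have [[p0 p1]|nS] := pselect (simplex p); last by exists x0.
  have [|x Hx] := prj_surj (y := fun i => \sum_k p ord0 k *: prj i (z k)); last by exists x.
  by move=> i; apply: convex_sum.
pose f (p : 'rV[R]_n) : 'rV[R]_n := \row_k w k (g p).
have fS p : simplex p -> simplex (f p).
  split=> [i|]; first by rewrite mxE.
  by under eq_bigr do rewrite mxE.
have [p pS fp] : exists2 p, simplex p & f p = p.
  apply: brouwer_simplex => // p k pS; rewrite mxE.
  under eq_fun do rewrite mxE.
  move=> N /(wC k); rewrite nbhsE => -[G [oG Gp] GN].
  have [s [e e0 Hs]] := prj_nbhs oG Gp.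
  pose v i (q : 'rV[R]_n) := \sum_k q ord0 k *: prj i (z k).
  have near_s : \forall q \near p, forall i, i \in s -> `|v i p - v i q| < e.
    apply: (@filter_forall_seq _ (nbhs p) _ s (fun i q => `|v i p - v i q| < e)) => i _.
    suff : v i q @[q --> p] --> v i p.
      by move/cvgrPdist_lt; apply.
    apply: (@cvg_big _ _ _ _ _ add_continuous _ (nbhs p) _ _ _ (nbhs_filter p)) => j _.
    by apply: cvgZr_tmp; exact: coord_continuous.
  suff : \forall q \near p, simplex q -> N (w k (g q)) by [].
  by apply: filterS near_s => q Hq qS; apply/GN/Hs => i /Hq; rewrite !gP.
by exists (g p) => i; rewrite gP // -{1}fp; apply: eq_bigr => k _; rewrite mxE.
Qed.

(** Schauder's approximation: averaging finitely many values of [f] by a fine partition of unity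
    gives a map with a fixed point, at which [gap] is small. The continuous [gap] attains its
    minimum on a compact space, and this minimum must be zero. *)
Lemma product_fixed_point (f : I -> X -> Y) (s : seq I) :
  X -> (forall i, continuous (f i)) -> (forall i x, A i (f i x)) ->
  exists x, forall i, i \in s -> prj i x = f i x.
Proof.
move=> x0 fC fA; pose gap x := \sum_(i <- s) `|prj i x - f i x|.
have gapC : continuous gap.
  move=> x; apply: continuous_sum => i ?.
  by apply: cvg_norm; apply: cvgB; [exact: prj_continuous|exact: fC].
have approx (e : R) : 0 < e -> exists x, gap x <= (size s)%:R * e.
  move=> e0; pose G x : set X := [set x' | \sum_(i <- s) `|f i x - f i x'| < e].
  have oG x : open (G x).
    apply: (@open_comp _ _ (fun x' => \sum_(i <- s) `|f i x - f i x'|) [set r | r < e]);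
      last exact: open_lt.
    move=> x' _; apply: continuous_sum => i ?.
    by apply: cvg_norm; apply: cvgB; [exact: cvg_cst|exact: fC].
  have Gx x : G x x by rewrite /G /= big1 // => i _; rewrite subrr normr0.
  have [n [z [w [wP wG]]]] := partition_of_unity X_compact b_base oG Gx.
  have /choice[T TP] : forall x, exists y, forall i, prj i y = f i x.
    by move=> x; apply: (prj_surj (y := fun i => f i x)).
  have [x Hx] := fixed_combination (T \o z) x0 wP; have [_ w0 w1] := wP.
  exists x; rewrite mulr_natl -iter_addr_0 -(count_predT s) -big_const_seq.
  rewrite /gap big_seq [leRHS]big_seq.
  apply: ler_sum => i si; rewrite Hx -[f i x]scale1r -(w1 x) scaler_suml -sumrB.
  apply: le_trans (ler_norm_sum _ _ _) _; rewrite -[e]mul1r -(w1 x) mulr_suml.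
  apply: ler_sum => k _; rewrite -scalerBr normrZ (ger0_norm (w0 _ _)) /= TP.
  have [->|wk] := eqVneq (w k x) 0; first by rewrite !mul0r.
  apply: ler_wpM2l => //; have : G (z k) x by apply: wG; rewrite lt_def wk w0.
  move=> /ltW; apply: le_trans; rewrite (big_rem i) //= lerDl.
  by apply: sumr_ge0.
have [||x _ xmin] := @compact_EVT_min X R gap setT _ X_compact.
- by exists x0.
- exact: continuous_subspaceT.
suff gap0 : gap x = 0.
  exists x => i si; apply/eqP; rewrite -subr_eq0 -normr_le0 -gap0 /gap (big_rem i) //= lerDl.
  by apply: sumr_ge0.
apply/eqP; rewrite eq_le sumr_ge0 // andbT leNgt; apply/negP => gap_gt0.
(* Dividing the minimum by [(size s).+1] makes [(size s)%:R * e] strictly smaller than it. *)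
have [x'] := approx _ (divr_gt0 gap_gt0 (ltr0Sn R (size s))).
rewrite leNgt => /negP; apply; apply: lt_le_trans (xmin x' (mem_set Logic.I)).
by rewrite mulrCA gtr_pMr // ltr_pdivrMr // mul1r ltr_nat.
Qed.

End ProductFixedPoint.

(** * Selections of lower semicontinuous correspondences *)

Lemma exprn_half_lt (R : realType) (M e : R) : 0 < e -> exists n : nat, M * 2^-1 ^+ n < e.
Proof.
move=> e0; have : (M * 2^-1 ^+ n) @[n --> \oo] --> M * 0.
  by apply: cvgMl_tmp; apply: cvg_expr; rewrite gtr0_norm ?invr_gt0 // invf_lt1 // ltr1n.
rewrite mulr0 => /cvgrPdist_lt/(_ e e0)[n _ /(_ n (leqnn n))] /=.
by rewrite sub0r normrN => /(le_lt_trans (ler_norm _)); exists n.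
Qed.

Lemma addr_lt_of_half (R : realType) (u v c e : R) :
  u <= c -> v <= c -> c < e / 2 -> u + v < e.
Proof. lra. Qed.

Lemma addr_lt_of_two_thirds (R : realType) (u v c e : R) :
  u <= c *+ 2 -> c < e / 3 -> v < e / 3 -> u + v < e.
Proof. rewrite mulr2n; lra. Qed.

Section NormClosure.
Context (R : realType) (Y : normedModType R).

Lemma closure_normP (C : set Y) p :
  closure C p <-> forall e, 0 < e -> exists2 u, C u & `|p - u| < e.
Proof.
split=> [clp e e0|H B /nbhs_ballP[e /= e0 He]].
  have [u [Cu]] := clp _ (nbhsx_ballx p e e0).
  by rewrite -ball_normE; exists u.
by have [u Cu pu] := H e e0; exists u; split=> //; apply: He; rewrite -ball_normE.
Qed.

Lemma norm_convex_lt (a b : Y) (t e : R) : 0 <= t <= 1 -> `|a| < e -> `|b| < e ->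
  `|t *: a + (1 - t) *: b| < e.
Proof.
move=> /andP[t0 t1] ae be; apply: le_lt_trans (ler_normD _ _) _.
rewrite !normrZ (ger0_norm t0) ger0_norm ?subr_ge0 //.
have [t_eq0|t_neq0] := eqVneq t 0; first by rewrite t_eq0 mul0r add0r subr0 mul1r.
have tp : 0 < t by rewrite lt_def t_neq0.
have -> : e = t * e + (1 - t) * e by ring.
by apply: ltr_leD; [rewrite ltr_pM2l|rewrite ler_wpM2l ?subr_ge0 // ltW].
Qed.

Lemma closure_convex (C : set Y) : @convex_set R Y C -> @convex_set R Y (closure C).
Proof.
move=> /convex_setP cC; apply/convex_setP => p q t t01 /closure_normP clp /closure_normP clq.
apply/closure_normP => e e0; have [u Cu pu] := clp e e0; have [v Cv qv] := clq e e0.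
exists (t *: u + (1 - t) *: v); first exact: cC.
by rewrite opprD addrACA -!scalerBr; exact: norm_convex_lt.
Qed.

Lemma ball_convex (a : Y) e : @convex_set R Y [set y | `|a - y| < e].
Proof.
apply/convex_setP => p q t t01 /= ap aq.
have -> : a - (t *: p + (1 - t) *: q) = t *: (a - p) + (1 - t) *: (a - q).
  by rewrite !scalerBr addrACA -opprD -scalerDl (addrC t) subrK scale1r.
exact: norm_convex_lt.
Qed.

End NormClosure.

Section UniformLimit.
Context (R : realType) (X : topologicalType) (Y : completeNormedModType R).

Lemma uniform_limit (f : nat -> X -> Y) (M : R) :
  (forall n, continuous (f n)) ->
  (forall n x, `|f n.+1 x - f n x| <= M * 2^-1 ^+ n) ->
  exists2 g, continuous g & forall n x, `|g x - f n x| <= 2 * M * 2^-1 ^+ n.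
Proof.
(* The difference of two powers lets the induction on [k] close. *)
move=> fC step; have step_add n k x :
    `|f (n + k)%N x - f n x| <= 2 * M * (2^-1 ^+ n - 2^-1 ^+ (n + k)).
  elim: k => [|k IH]; first by rewrite addn0 !subrr normr0 mulr0.
  rewrite -(subrK (f (n + k)%N x) (f (n + k.+1)%N x)) -addrA.
  apply: le_trans (ler_normD _ _) _.
  have := step (n + k)%N x; rewrite -addnS => step_nk; apply: le_trans (lerD step_nk IH) _.
  rewrite [2^-1 ^+ (n + k.+1)](_ : _ = 2^-1 ^+ (n + k) / 2); last by rewrite addnS exprSr.
  by set a := 2^-1 ^+ n; set b := 2^-1 ^+ _; lra.
(* The sign of [M] can be read off only at a point of [X]. *)
have x_M (x : X) : 0 <= M.
  by have := le_trans (normr_ge0 _) (step 0%N x); rewrite expr0 mulr1.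
have bound n k x : `|f (n + k)%N x - f n x| <= 2 * M * 2^-1 ^+ n.
  apply: le_trans (step_add n k x) _; apply: ler_wpM2l.
    by rewrite mulr_ge0 // (x_M x).
  by rewrite gerBl exprn_ge0 // invr_ge0.
have f_cvg x : cvg (f n x @[n --> \oo]).
  apply/cauchy_cvgP/cauchy_ballP => e e0.
  have [n Hn] := exprn_half_lt (2 * M) (divr_gt0 e0 (ltr0Sn R 1)).
  exists ([set f m x | m in [set m | (n <= m)%N]], [set f m x | m in [set m | (n <= m)%N]]).
    by split; exists n => // m nm; exists m.
  move=> [_ _] /= [[p np <-] [q nq <-]]; rewrite -ball_normE /=.
  rewrite -(subrK (f n x) (f p x)) -addrA; apply: le_lt_trans (ler_normD _ _) _.
  have := bound n (p - n)%N x; have := bound n (q - n)%N x; rewrite !subnKC // => hq hp.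
  by rewrite [X in _ + X]distrC; exact: addr_lt_of_half hp hq Hn.
pose g x := lim (f n x @[n --> \oo]).
have g_bound n x : `|g x - f n x| <= 2 * M * 2^-1 ^+ n.
  have gf : `|f m x - f n x| @[m --> \oo] --> `|g x - f n x|.
    by apply: cvg_norm; apply: cvgB; [exact: f_cvg|exact: cvg_cst].
  apply: (cvgr_to_le gf); exists n => // m /= nm; rewrite -(subnKC nm); exact: bound.
exists g => // x; apply/cvgrPdist_lt => e e0.
have [n Hn] := exprn_half_lt (2 * M) (divr_gt0 e0 (ltr0Sn R 2)).
have /cvgrPdist_lt/(_ _ (divr_gt0 e0 (ltr0Sn R 2))) := fC n x.
apply: filterS => x' fx'; have hx := g_bound n x; have hx' := g_bound n x'.
have -> : g x - g x' = (g x - f n x) + (f n x' - g x') + (f n x - f n x').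
  by rewrite addrAC subrKA addrA subrK.
apply: le_lt_trans (ler_normD _ _) _; apply: (@addr_lt_of_two_thirds _ _ _ (2 * M * 2^-1 ^+ n)) => //.
by apply: le_trans (ler_normD _ _) _; rewrite [X in _ + X]distrC mulr2n; apply: lerD.
Qed.

End UniformLimit.

(** * Michael's selection theorem *)

Section Selections.
Context (R : realType) (X : topologicalType) (Y : completeNormedModType R).
Implicit Types Phi : X -> set Y.

Lemma lsc_near Phi : lsc_correspondence Phi <->
  forall x y e, Phi x y -> 0 < e ->
    \forall x' \near x, exists2 y', Phi x' y' & `|y - y'| < e.
Proof.
split=> [lPhi x y e xy e0|H V oV].
  have oB : open [set z | `|y - z| < e].
    by rewrite (_ : [set z | _] = ball y e); [exact: ball_open|rewrite -ball_normE].
  have Ux : Phi x `&` [set z | `|y - z| < e] !=set0.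
    by exists y; split=> //=; rewrite subrr normr0.
  apply: filterS (open_nbhs_nbhs (conj (lPhi _ oB) Ux)) => x' [y' [x'y' yy']].
  by exists y'.
rewrite openE => x [y [xy Vy]].
move: oV; rewrite openE => /(_ _ Vy)/nbhs_ballP[e /= e0 eV].
apply: filterS (H x y e xy e0) => x' [y' x'y' yy'].
by exists y'; split=> //; apply: eV; rewrite -ball_normE.
Qed.

Definition convex_valued Phi := forall x, @convex_set R Y (Phi x).
Definition nonempty_valued Phi := forall x, Phi x !=set0.

(** Michael's iteration cuts the values down to a ball about the previous approximation. The
    inequality is strict, so it survives small changes of [f] and of the chosen value. *)
Lemma lsc_ball Phi (f : X -> Y) e : lsc_correspondence Phi -> continuous f ->
  lsc_correspondence (fun x => Phi x `&` [set y | `|f x - y| < e]).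
Proof.
move=> /lsc_near lPhi fC; apply/lsc_near => x y d [xy fxy] d0.
pose r := Num.min d ((e - `|f x - y|) / 2).
have r0 : 0 < r by rewrite lt_min d0 divr_gt0 // subr_gt0.
have /cvgrPdist_lt/(_ _ r0) fx := fC x.
apply: filterS2 fx (lPhi x y r xy r0) => x' ff' [y' x'y' yy'].
exists y'; last by apply: lt_le_trans yy' _; rewrite ge_min lexx.
split=> //=; have -> : f x' - y' = (f x' - f x) + (y - y') + (f x - y).
  by rewrite addrAC subrKA addrA subrK.
apply: le_lt_trans (ler_normD _ _) _; rewrite -ltrBrDr.
apply: le_lt_trans (ler_normD _ _) _; rewrite distrC.
have r_le : r <= (e - `|f x - y|) / 2 by rewrite ge_min lexx orbT.
by rewrite [ltRHS]splitr; apply: ltrD; [exact: lt_le_trans ff' r_le|exact: lt_le_trans yy' r_le].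
Qed.

(** A value [y x] stays within [e / 2] of [Phi x'] for [x'] near [x]. A partition of unity averages
    these constants, and convexity keeps the average of the nearby values in [Phi x']. *)
Lemma approx_selection (C : Type) (b : C -> X -> R) Phi e :
  compact [set: X] -> bump_base b -> lsc_correspondence Phi -> convex_valued Phi ->
  nonempty_valued Phi -> 0 < e ->
  exists2 f : X -> Y, continuous f & forall x, exists2 u, Phi x u & `|f x - u| < e.
Proof.
move=> cX bB lPhi cPhi /choice[y Hy] e0.
have e20 : 0 < e / 2 by rewrite divr_gt0.
pose G x : set X := [set x' | Phi x' `&` [set z | `|y x - z| < e / 2] !=set0].
have oG x : open (G x).
  apply: lPhi; rewrite (_ : [set z | _] = ball (y x) (e / 2)); first exact: ball_open.
  by rewrite -ball_normE.
have Gx x : G x x by exists (y x); split=> //=; rewrite subrr normr0.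
have [n [z [w [[wC w0 w1] wG]]]] := partition_of_unity cX bB oG Gx.
exists (fun x => \sum_k w k x *: y (z k)).
  move=> x; apply: continuous_sum => k ?.
  by apply: cvgZr_tmp; exact: wC.
move=> x; have /choice[u Hu] : forall k, exists u, 0 < w k x -> Phi x u /\ `|y (z k) - u| < e / 2.
  move=> k; have [/wG[u [xu yu]]|_] := boolP (0 < w k x); first by exists u.
  by exists 0.
exists (\sum_k w k x *: u k).
  by apply: convex_sum => // k /Hu[].
rewrite -sumrB; apply: le_lt_trans (ler_norm_sum _ _ _) _.
have e2e : e / 2 < e by rewrite ltr_pdivrMr // ltr_pMr // ltr1n.
apply: le_lt_trans e2e; rewrite -[e / 2]mul1r -{1}(w1 x) mulr_suml.
apply: ler_sum => k _; rewrite -scalerBr normrZ ger0_norm //.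
have [->|wk] := eqVneq (w k x) 0; first by rewrite !mul0r.
have wp : 0 < w k x by rewrite lt_def wk w0.
by apply: ler_wpM2l; [exact: w0|apply/ltW; have [] := Hu k wp].
Qed.

(** Each approximate selection is taken in the correspondence restricted to a ball about the
    previous one, so the increments are summable and the limit is uniform. *)
Lemma closure_selection (C : Type) (b : C -> X -> R) Phi :
  compact [set: X] -> bump_base b -> lsc_correspondence Phi -> convex_valued Phi ->
  nonempty_valued Phi ->
  exists2 f : X -> Y, continuous f & forall x, closure (Phi x) (f x).
Proof.
move=> cX bB lPhi cPhi nPhi; pose h n : R := 2^-1 ^+ n.
have h0 n : 0 < h n by rewrite exprn_gt0 // invr_gt0.
pose good n (f : X -> Y) := continuous f /\ forall x, exists2 u, Phi x u & `|f x - u| < h n.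
have /choice[next Hnext] : forall nf : nat * (X -> Y), exists f', good nf.1 nf.2 ->
    good nf.1.+1 f' /\ forall x, `|f' x - nf.2 x| <= 2 * h nf.1.
  move=> [n f] /=; have [[fC fP]|ng] := pselect (good n f); last by exists f.
  have [|x|f' f'C f'P] := approx_selection cX bB (lsc_ball (h n) lPhi fC) _ _ (h0 n.+1).
  - move=> x; apply/convex_setP => p q t t01 [xp fp] [xq fq]; split.
      by move/convex_setP: (cPhi x); exact.
    by move/convex_setP: (ball_convex (a := f x) (e := h n)); exact.
  - by have [u xu fu] := fP x; exists u.
  exists f' => _; split=> [|x]; first by split=> // x; have [u []] := f'P x; exists u.
  have [u [xu fu] f'u] := f'P x; rewrite -(subrK u (f' x)) -addrA.
  apply: le_trans (ler_normD _ _) _; rewrite [X in _ + X]distrC mulr2n mulrDl mul1r.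
  apply: lerD; last exact: ltW.
  by apply: (le_trans (ltW f'u)); rewrite /h exprS ler_piMl ?exprn_ge0 ?invr_ge0 // invf_le1 // ler1n.
have [f0 f0C f0P] := approx_selection cX bB lPhi cPhi nPhi (h0 0%N).
pose f := fix f n := if n is m.+1 then next (m, f m) else f0.
have fgood n : good n (f n).
  by elim: n => [//|n IH] /=; have [] := Hnext (n, f n) IH.
have fstep n x : `|f n.+1 x - f n x| <= 2 * h n.
  by have [_] := Hnext (n, f n) (fgood n); apply.
have [g gC gf] := uniform_limit (fun n => (fgood n).1) fstep.
exists g => // x; apply/closure_normP => e e0.
(* Five is [2 * 2], from the uniform limit of steps bounded by [2 * h n], plus one for the distance
   of [f n x] to [Phi x]. *)
have [n Hn] := exprn_half_lt 5 e0; have [u xu fu] := (fgood n).2 x.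
exists u => //; rewrite -(subrK (f n x) (g x)) -addrA; apply: le_lt_trans (ler_normD _ _) _.
apply: le_lt_trans Hn; rewrite [leRHS](_ : _ = 2 * 2 * h n + h n); last by rewrite /h; ring.
by apply: lerD; [exact: gf|exact: ltW].
Qed.

End Selections.

Lemma natinv_lt (R : realType) (e : R) : 0 < e -> exists n : nat, n.+1%:R^-1 < e.
Proof.
by move=> e0; have [n _ /(_ n (leqnn n))] := near_infty_natSinv_lt (PosNum e0); exists n.
Qed.

Lemma separable_sequence (R : realType) (Y : normedModType R) : separable Y ->
  exists a : nat -> Y, forall y e, 0 < e -> exists n, `|a n - y| < e.
Proof.
move=> [D /countable_injP[code codeI] dD].
exists (fun n => xget 0 [set y | D y /\ code y = n]) => y e e0.
have [|z [yz Dz]] := dD (ball y e) _ (ball_open y e).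
  by exists y; exact: ballxx.
exists (code z); move: yz; rewrite -ball_normE /= distrC.
case: xgetP => [z' _ [Dz' zz']|/(_ z)[]//].
by have -> : z' = z by apply: codeI; rewrite ?inE.
Qed.

(** * Interior points relative to closed affine subspaces *)

Section RelativeInterior.
Context (R : realType) (Y : normedModType R).

Definition closed_subspace (V : set Y) := [/\ closed V, V 0,
  forall u v, V u -> V v -> V (u + v) & forall (t : R) u, V u -> V (t *: u)].

(** [C] lies in the closed affine subspace [c + V] and has [c] as an interior point relative to
    it. *)
Definition solid (C : set Y) := exists c r V, [/\ 0 < r, closed_subspace V,
  forall y, C y -> V (y - c) & forall v, V v -> `|v| < r -> C (c + v)].

Lemma solid_interior (C : set Y) : C° !=set0 -> solid C.
Proof.
move=> [c /nbhs_ballP[r /= r0 Hr]]; exists c, r, setT; split=> //.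
by move=> v _ vr; apply: Hr; rewrite -ball_normE /= opprD addNKr normrN.
Qed.

Lemma closed_subspaceB V : closed_subspace V -> forall u v, V u -> V v -> V (u - v).
Proof. by move=> [_ _ VD VZ] u v Vu Vv; apply: VD => //; rewrite -scaleN1r; exact: VZ. Qed.

Lemma closed_subspace_closure V (C : set Y) c p : closed_subspace V ->
  (forall y, C y -> V (y - c)) -> closure C p -> V (p - c).
Proof.
move=> [clV _ _ _] CV /closure_normP clp; apply: clV; apply/closure_normP => e e0.
have [u Cu pu] := clp e e0; exists (u - c); first exact: CV.
by rewrite opprB addrA subrK.
Qed.

(** The closure point [q] is replaced by a nearby [q'] in [C]; the resulting error, together with
    [v], is doubled and absorbed by the ball about [p]. *)
Lemma relative_interior_half (C V : set Y) c r p q :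
  @convex_set R Y C -> closed_subspace V -> (forall y, C y -> V (y - c)) ->
  (0 < r) -> V (p - c) -> (forall v, V v -> `|v| < r -> C (p + v)) -> closure C q ->
  forall v, V v -> `|v| < r / 2 -> C (2^-1 *: (p + q) + v).
Proof.
move=> /convex_setP cC sV CV r0 Vp Hp clq v Vv vr.
have Vq := closed_subspace_closure sV CV clq.
have /closure_normP clq' := clq.
have [q' Cq' qq'] : exists2 q', C q' & `|q - q'| < r - 2 * `|v|.
  by apply: clq'; rewrite subr_gt0 mulrC -ltr_pdivlMr.
have -> : 2^-1 *: (p + q) + v =
    2^-1 *: (p + (2 *: v + (q - q'))) + (1 - 2^-1) *: q'.
  have -> : 1 - 2^-1 = 2^-1 :> R by field.
  rewrite -scalerDr -!addrA addNr addr0 [2 *: v + q]addrC addrA [RHS]scalerDr.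
  by rewrite scalerA mulVf ?scale1r.
apply: cC => //; first by rewrite invr_ge0 ler0n invf_le1 // ler1n.
apply: Hp.
  have [_ _ VD VZ] := sV; apply: (VD); first exact: VZ.
  by have := closed_subspaceB sV Vq (CV _ Cq'); rewrite opprB subrKA.
apply: le_lt_trans (ler_normD _ _) _; rewrite normrZ ger0_norm //.
by rewrite -ltrBrDl.
Qed.

End RelativeInterior.

(** * Countable dense families of selections *)

Section DenseSelections.
Context (R : realType) (X : topologicalType) (Y : completeNormedModType R).
Context (C : countType) (b : C -> X -> R) (Phi : X -> set Y).
Hypothesis X_compact : compact [set: X].
Hypothesis b_base : bump_base b.
Hypothesis Phi_lsc : lsc_correspondence Phi.
Hypothesis Phi_convex : convex_valued Phi.
Hypothesis Phi_nonempty : nonempty_valued Phi.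

(** Requiring values in [V] over [W] only preserves lower semicontinuity because [V] is open and [W]
    is closed. *)
Lemma constrained_selection (W : set X) (V : set Y) :
  closed W -> open V -> @convex_set R Y V -> (forall x, W x -> Phi x `&` V !=set0) ->
  exists2 f : X -> Y, continuous f &
    forall x, closure (Phi x) (f x) /\ (W x -> closure V (f x)).
Proof.
move=> clW oV cV WV; pose Psi x := Phi x `&` [set y | W x -> V y].
have [||x|f fC fPsi] := closure_selection (Phi := Psi) X_compact b_base.
- apply/lsc_near => x y e [xy Wxy] e0.
  have [Wx|nWx] := pselect (W x).
    have /nbhs_ballP[d /= d0 dV] := open_nbhs_nbhs (conj oV (Wxy Wx)).
    have de0 : 0 < Num.min d e by rewrite lt_min d0.
    have := (lsc_near Phi).1 Phi_lsc x y _ xy de0; apply: filterS => x' [y' x'y'].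
    rewrite lt_min => /andP[yd ye]; exists y' => //; split=> // _.
    by apply: dV; rewrite -ball_normE.
  have nW : \forall x' \near x, ~ W x'.
    by apply: (open_nbhs_nbhs (A := ~` W)); split=> //; exact: closed_openC.
  have := (lsc_near Phi).1 Phi_lsc x y _ xy e0; apply: filterS2 nW => x' nWx' [y' x'y' ye].
  by exists y' => //; split.
- move=> x; apply/convex_setP => p q t t01 [xp Wp] [xq Wq]; split.
    by move/convex_setP: (@Phi_convex x); exact.
  by move=> Wx; move/convex_setP: cV; apply; [|exact: Wp|exact: Wq].
- have [Wx|nWx] := pselect (W x).
    by have [y [xy Vy]] := WV x Wx; exists y; split.
  by have [y xy] := Phi_nonempty x; exists y; split.
exists f => // x; split.
  by apply: closure_subset (fPsi x) => y [].
by move=> Wx; apply: closure_subset (fPsi x) => y [_ /(_ Wx)].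
Qed.

(** One selection is made for each closed set [W k m] and each ball [V d r] about a point of a dense
    sequence, constrained whenever [Phi] meets the ball all over [W k m]. For [y] in [Phi x], a
    small ball contains [y], and [Phi] still meets it on some [W k m] containing [x]. *)
Lemma dense_selections : separable Y -> exists f : nat -> X -> Y,
  [/\ forall n, continuous (f n), forall n x, closure (Phi x) (f n x) &
      forall x y e, Phi x y -> 0 < e -> exists n, `|f n x - y| < e].
Proof.
move=> /separable_sequence[a aP].
have [g gC gPhi] := closure_selection X_compact b_base Phi_lsc Phi_convex Phi_nonempty.
pose W k m := [set x | m.+1%:R^-1 <= b k x]; pose V d r := [set y | `|a d - y| < r.+1%:R^-1 :> R].
have /choice[s sP] : forall j : C * nat * (nat * nat), exists f : X -> Y,
    [/\ continuous f, forall x, closure (Phi x) (f x) &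
        (forall x, W j.1.1 j.1.2 x -> Phi x `&` V j.2.1 j.2.2 !=set0) ->
        forall x, W j.1.1 j.1.2 x -> closure (V j.2.1 j.2.2) (f x)].
  move=> [[k m] [d r]] /=.
  have [WV|nWV] := pselect (forall x, W k m x -> Phi x `&` V d r !=set0); last by exists g.
  have [||||f fC fP] := @constrained_selection (W k m) (V d r).
  - apply: (@preimage_closed _ _ (b k) [set t | m.+1%:R^-1 <= t]); last exact: closed_ge.
    by move=> x _; exact: b_base.1.
  - rewrite /V (_ : [set _ | _] = ball (a d) r.+1%:R^-1); first exact: ball_open.
    by rewrite -ball_normE.
  - exact: ball_convex.
  - exact: WV.
  by exists f; split=> // [x|_ x]; have [] := fP x.
exists (fun n => if unpickle n is Some j then s j else g); split=> [n|n x|x y e xy e0].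
- by case: unpickle => // j; have [] := sP j.
- by case: unpickle => // j; have [_ + _] := sP j; exact.
have [r Hr] := natinv_lt (divr_gt0 e0 (ltr0Sn R 2)).
have r0 : 0 < r.+1%:R^-1 :> R by rewrite invr_gt0 ltr0Sn.
have [d Hd] := aP y _ r0.
have oV : open (V d r).
  rewrite /V (_ : [set _ | _] = ball (a d) r.+1%:R^-1); first exact: ball_open.
  by rewrite -ball_normE.
have xV : Phi x `&` V d r !=set0 by exists y.
have [k bkx bkV] := b_base.2 _ _ (Phi_lsc oV) xV.
have [m Hm] := natinv_lt bkx.
exists (pickle (k, m, (d, r))); rewrite pickleK.
have [_ _ /=] := sP (k, m, (d, r)).
have WV x' : W k m x' -> Phi x' `&` V d r !=set0.
  by move=> Wx'; apply: bkV; apply: lt_le_trans Wx'; rewrite invr_gt0 ltr0Sn.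
move=> /(_ WV x (ltW Hm))/closure_normP/(_ _ (divr_gt0 e0 (ltr0Sn R 2)))[v Vv].
set fx := s _ x => fv.
have -> : fx - y = (fx - v) + (v - a d) + (a d - y) by rewrite subrKA addrA subrK.
apply: le_lt_trans (ler_normD _ _) _.
have -> : e = e / 3 + e / 3 + e / 3 by field.
apply: ltrD (lt_trans Hd Hr); apply: le_lt_trans (ler_normD _ _) _.
by apply: ltrD fv _; rewrite distrC; exact: lt_trans Vv Hr.
Qed.

End DenseSelections.

Section HalvingLimits.
Context (R : realType) (X : topologicalType) (Y : completeNormedModType R).

(* [L n] is the series [f n / 2 + f (n + 1) / 4 + ...]. *)
Lemma halving_limits (f : nat -> X -> Y) (M : R) :
  (forall n, continuous (f n)) -> (forall n x, `|f n x| <= M) ->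
  exists L : nat -> X -> Y, [/\ forall n, continuous (L n),
    forall n x, L n x = 2^-1 *: (f n x + L n.+1 x) &
    forall (D : set Y) n x, closed D -> @convex_set R Y D -> (forall k, D (f k x)) -> D (L n x)].
Proof.
(* The truncated series puts the remaining weight on its last term; it is thus a convex combination
   and stays in every convex set that contains the terms. *)
move=> fC fM; pose S := fix S N n x := if N is N'.+1 then 2^-1 *: (f n x + S N' n.+1 x) else f n x.
have SC N n : continuous (S N n).
  elim: N n => [|N IH] n x /=; first exact: fC.
  by apply: cvgZl_tmp; apply: cvgD; [exact: fC|exact: IH].
have half0 : (0 : R) <= 2^-1 by rewrite invr_ge0.
have Sstep n N x : `|S N.+1 n x - S N n x| <= M * 2^-1 ^+ N.
  elim: N n => [|N IH] n.
    have fE : f n x = 2^-1 *: f n x + 2^-1 *: f n x.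
      by rewrite -scalerDl (_ : 2^-1 + 2^-1 = 1 :> R) ?scale1r //; field.
    rewrite /= expr0 mulr1 [X in _ - X]fE scalerDr opprD addrACA subrr add0r -scalerBr.
    rewrite normrZ ger0_norm //.
    rewrite -ler_pdivlMl ?invr_gt0 // invrK mulrC.
    by apply: le_trans (ler_normB _ _) _; rewrite mulr_natr mulr2n; apply: lerD.
  rewrite [S N.+2 n x]/= [S N.+1 n x]/= -scalerBr normrZ ger0_norm //.
  rewrite opprD addrACA subrr add0r exprS mulrCA; apply: ler_wpM2l => //; exact: IH.
have /choice[L LP] : forall n, exists g, continuous g /\
    forall N x, `|g x - S N n x| <= 2 * M * 2^-1 ^+ N.
  move=> n; have [g gC gS] := @uniform_limit _ _ _ (fun N => S N n) M (fun N => SC N n) (Sstep n).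
  by exists g.
have LS n N x := (LP n).2 N x.
exists L; split=> [n|n x|D n x clD cD Df]; first exact: (LP n).1.
  apply/eqP; rewrite -subr_eq0 -normr_le0; apply/ler_addgt0Pl => e e0; rewrite addr0.
  have [N HN] := exprn_half_lt (2 * M) (divr_gt0 e0 (ltr0Sn R 1)).
  rewrite -(subrKA (S N.+1 n x)) /=.
  apply/ltW; apply: le_lt_trans (ler_normD _ _) _.
  apply: (addr_lt_of_half _ _ HN).
    apply: le_trans (LS n N.+1 x) _; rewrite exprS.
    rewrite mulrCA ler_piMl ?invf_le1 ?ler1n //; exact: le_trans (normr_ge0 _) (LS n N x).
  rewrite -scalerBr normrZ ger0_norm // opprD addrACA subrr add0r distrC.
  have := LS n.+1 N x => h; apply: le_trans h; rewrite ler_piMl ?invf_le1 ?ler1n //.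
have SD N k : D (S N k x).
  elim: N k => [|N IH] k //=; rewrite scalerDr.
  have {2}-> : 2^-1 = 1 - 2^-1 :> R by field.
  by move/convex_setP: cD; apply => //; rewrite half0 invf_le1 // ler1n.
apply: clD; apply/closure_normP => e e0; have [N HN] := exprn_half_lt (2 * M) e0.
by exists (S N n x) => //; exact: le_lt_trans (LS n N x) HN.
Qed.

End HalvingLimits.

(** If [Phi x] is solid, some [f n x] is close to its centre and therefore relatively interior.
    Averaging with a point of the closure preserves this, so the weighted mean of the whole sequence
    is relatively interior and lies in [Phi x] itself. *)
Lemma solid_selection (R : realType) (X : topologicalType) (Y : completeNormedModType R)
    (C : countType) (b : C -> X -> R) (Phi : X -> set Y) (M : R) :
  compact [set: X] -> bump_base b -> separable Y -> lsc_correspondence Phi ->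
  convex_valued Phi -> nonempty_valued Phi -> (forall x y, Phi x y -> `|y| <= M) ->
  exists2 f : X -> Y, continuous f &
    forall x, closure (Phi x) (f x) /\ (solid (Phi x) -> Phi x (f x)).
Proof.
move=> cX bB sepY lPhi cPhi nPhi PhiM.
have [f [fC fPhi fdense]] := dense_selections cX bB lPhi cPhi nPhi sepY.
have fM n x : `|f n x| <= M.
  apply/ler_addgt0Pl => e e0; have /closure_normP/(_ e e0)[u xu fu] := fPhi n x.
  rewrite -(subrK u (f n x)); apply: le_trans (ler_normD _ _) _.
  by apply: lerD; [exact: ltW|exact: (PhiM x u xu)].
have [L [LC LE LD]] := halving_limits fC fM.
have Lcl n x : closure (Phi x) (L n x).
  apply: LD => [|k|k]; [exact: closed_closure|apply: closure_convex; exact: cPhi|exact: fPhi].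
exists (L 0%N) => // x; split=> // -[c [r [V [r0 sV CV Hr]]]].
have [_ V0 _ _] := sV.
have cx : Phi x c by rewrite -[c]addr0; apply: Hr => //; rewrite normr0.
have [n fn] := fdense x c (r / 2) cx (divr_gt0 r0 (ltr0Sn R 1)).
(* That is, [p] is an interior point of [Phi x] relative to [c + V]. *)
pose deep p := V (p - c) /\ exists2 s, 0 < s & forall v, V v -> `|v| < s -> Phi x (p + v).
have Vcl p : closure (Phi x) p -> V (p - c) by exact: closed_subspace_closure.
have deep_half p q : deep p -> closure (Phi x) p -> closure (Phi x) q -> deep (2^-1 *: (p + q)).
  move=> [Vp [s s0 Hs]] clp clq; split.
    apply: Vcl; rewrite scalerDr; have {2}-> : 2^-1 = 1 - 2^-1 :> R by field.
    have /convex_setP : @convex_set R Y (closure (Phi x)) by apply: closure_convex; exact: cPhi.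
    by apply => //; rewrite invr_ge0 ler0n invf_le1 // ler1n.
  exists (s / 2); first by rewrite divr_gt0.
  exact: (relative_interior_half (cPhi x) sV CV s0 Vp Hs clq).
have deep_f : deep (f n x).
  split; first by apply/Vcl/fPhi.
  exists (r / 2) => [|v Vv vr]; first by rewrite divr_gt0.
  rewrite -(subrK c (f n x)) [_ + c]addrC -addrA; apply: Hr.
    by have [_ _ VD _] := sV; apply: (VD); [apply/Vcl/fPhi|].
  by apply: le_lt_trans (ler_normD _ _) _; rewrite [ltRHS]splitr; apply: ltrD.
(* The recursion for [L] carries the property from the index [n] down to [0]. *)
have deep_L k : (k <= n)%N -> deep (L (n - k)%N x).
  elim: k => [_|k IH kn].
    by rewrite subn0 LE; apply: deep_half => //; exact: fPhi.
  rewrite LE addrC subnSK //; apply: deep_half; [exact: IH (ltnW kn)|exact: Lcl|exact: fPhi].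
have := deep_L n (leqnn n); rewrite subnn => -[_ [s s0 Hs]].
by rewrite -[L _ x]addr0; apply: Hs; rewrite ?normr0.
Qed.

(** * Convex sets in finite dimension have relative interior points *)

Section FiniteDimension.
Context (R : realType) (Y : normedModType R).

Lemma closed_subspace0 : closed_subspace [set 0 : Y].
Proof.
split=> //; last 2 first.
- by move=> u v /= -> ->; rewrite addr0.
- by move=> t u /= ->; rewrite scaler0.
move=> p /closure_normP clp /=; apply/eqP; rewrite -normr_le0; apply/ler_addgt0Pl => e e0.
by have [u -> /ltW] := clp e e0; rewrite subr0 addr0.
Qed.

Section AddLine.
Context (V : set Y) (w : Y).
Hypothesis V_sub : closed_subspace V.
Hypothesis w_notin : ~ V w.

Definition add_line : set Y := [set u | exists2 v, V v & exists t : R, u = v + t *: w].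

(** Here [d] bounds from below the distance of [w] to the closed set [V]; the general case follows
    by scaling with [t]. *)
Lemma add_line_distance : exists2 d : R, 0 < d & forall v t, V v -> d * `|t| <= `|v + t *: w|.
Proof.
have [clV _ _ VZ] := V_sub.
have [d d0 dP] : exists2 d : R, 0 < d & forall v, V v -> d <= `|w - v|.
  apply: contrapT => H; apply/w_notin/clV/closure_normP => e e0.
  apply: contrapT => He; apply: H; exists e => // v Vv; rewrite leNgt; apply/negP => wv.
  by apply: He; exists v.
exists d => // v t Vv; have [->|t0] := eqVneq t 0; first by rewrite normr0 mulr0.
have -> : v + t *: w = t *: (w - (- t^-1) *: v).
  by rewrite scaleNr opprK scalerDr scalerA divff // scale1r addrC.
by rewrite normrZ mulrC; apply: ler_wpM2l => //; apply: dP; exact: VZ.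
Qed.

Lemma closed_subspace_add_line : closed_subspace add_line.
Proof.
have [clV V0 VD VZ] := V_sub; split.
- move=> p /closure_normP clp; have [d d0 dP] := add_line_distance.
  have h0 n : (0 : R) < 2^-1 ^+ n by rewrite exprn_gt0 // invr_gt0.
  have /choice[vt vtP] : forall n, exists vt : Y * R, V vt.1 /\ `|p - (vt.1 + vt.2 *: w)| < 2^-1 ^+ n.
    by move=> n; have [u [v Vv [t ->]] pu] := clp _ (h0 n); exists (v, t).
  have step n (_ : R) : `|(vt n.+1).2 - (vt n).2| <= 2 / d * 2^-1 ^+ n.
    have [Vn pn] := vtP n; have [Vn1 pn1] := vtP n.+1.
    rewrite mulrAC ler_pdivlMr // mulrC; apply: le_trans (dP _ _ (closed_subspaceB V_sub Vn1 Vn)) _.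
    have -> : (vt n.+1).1 - (vt n).1 + ((vt n.+1).2 - (vt n).2) *: w =
        (p - ((vt n).1 + (vt n).2 *: w)) - (p - ((vt n.+1).1 + (vt n.+1).2 *: w)).
      by rewrite opprB [RHS]addrC subrKA scalerBl opprD addrACA.
    apply: le_trans (ler_normB _ _) _; rewrite mulrDl mul1r; apply: lerD; first exact: ltW.
    by apply: le_trans (ltW pn1) _; rewrite exprS ler_piMl ?ltW // invf_lt1 // ltr1n.
  (* The coefficients along [w] have summable increments by [add_line_distance]; viewed as constant
     functions they converge by [uniform_limit]. *)
  have [g _ gP] := @uniform_limit R R R (fun n _ => (vt n).2) _
    (fun n => @cst_continuous R R (vt n).2) step.
  pose t := g 0; have tP n : `|t - (vt n).2| <= 2 * (2 / d) * 2^-1 ^+ n := gP n 0.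
  exists (p - t *: w); last by exists t; rewrite subrK.
  apply/clV/closure_normP => e e0.
  have [n Hn] := exprn_half_lt (2 * (2 / d) * `|w| + 1) e0.
  have [Vn pn] := vtP n; exists (vt n).1 => //.
  have -> : p - t *: w - (vt n).1 = p - ((vt n).1 + (vt n).2 *: w) - (t - (vt n).2) *: w.
    by rewrite scalerBl opprB opprD !addrA subrK addrAC.
  apply: le_lt_trans (ler_normB _ _) _; apply: lt_le_trans (ltW Hn).
  rewrite mulrDl mul1r addrC; apply: ler_ltD => //; rewrite normrZ mulrAC.
  exact: ler_wpM2r.
- by exists 0 => //; exists 0; rewrite scale0r addr0.
- move=> _ _ [u Vu [s ->]] [v Vv [t ->]]; exists (u + v); first exact: VD.
  by exists (s + t); rewrite scalerDl addrACA.
- move=> s _ [v Vv [t ->]]; exists (s *: v); first exact: VZ.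
  by exists (s * t); rewrite scalerDr scalerA.
Qed.

End AddLine.

(** If [C] leaves [c + V] at some [y], the cone with apex [y] over the ball about [c] contains a
    ball about the midpoint of [c] and [y], relative to [V] enlarged by a line. An exchange then
    removes one of the spanning vectors, and the induction goes on. *)
Lemma solid_of_spanning (C : set Y) n (e : 'I_n -> Y) c r (V : set Y) :
  @convex_set R Y C -> 0 < r -> closed_subspace V -> (forall v, V v -> `|v| < r -> C (c + v)) ->
  (forall y, exists2 v, V v & exists k : 'I_n -> R, y = v + \sum_j k j *: e j) ->
  solid C.
Proof.
move=> cC; elim: n e c r V => [|n IH] e c r V r0 sV Hr span.
  exists c, r, V; split=> // y _; have [v Vv [k ->]] := span (y - c).
  by rewrite big_ord0 addr0.
have [CV|/existsNP[y /not_implyP[Cy yV]]] := pselect (forall y, C y -> V (y - c)).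
  by exists c, r, V.
set w := y - c in yV; have [clV V0 VD VZ] := sV.
have [d d0 dP] := add_line_distance sV yV.
have wd : 0 < 1 + `|w| / d by rewrite ltr_pwDl // divr_ge0 // ltW.
have [v0 Vv0 [k wE]] := span w.
have [j kj] : exists j, k j != 0.
  apply: contrapT => /forallNP k0; apply: yV; rewrite wE big1 ?addr0 // => j _.
  by have /negP := k0 j; rewrite negbK => /eqP->; rewrite scale0r.
(* The first bound forces the coefficient [t] of [w] below [1/4] in absolute value, the second
   forces the part in [V] below [r / 4]. So the weight [1/2 - t] of the ball exceeds [1/4], and
   dividing by it stays within [r]. *)
apply: (IH (e \o lift j) (c + 2^-1 *: w) (Num.min (d / 4) (r / 4 / (1 + `|w| / d))) (add_line V w)).
- by rewrite lt_min !divr_gt0.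
- exact: closed_subspace_add_line.
- move=> _ [v Vv [t ->]]; rewrite lt_min => /andP[ud ur].
  have t_lt : `|t| < 4^-1.
    by rewrite -(ltr_pM2l d0); apply: le_lt_trans (dP _ _ Vv) _.
  have v_lt : `|v| < r / 4.
    rewrite -[v](addrK (t *: w)); apply: le_lt_trans (ler_normB _ _) _.
    move: ur; rewrite ltr_pdivlMr //; apply: le_lt_trans.
    rewrite mulrDr mulr1 lerD2l normrZ mulrA mulrAC ler_wpM2r //.
    by rewrite ler_pdivlMr // mulrC; exact: dP.
  have [t1 t2] : -4^-1 < t /\ t < 4^-1 by move: t_lt; rewrite ltr_norml => /andP[].
  have s0 : 4^-1 < 2^-1 - t by lra.
  have s_gt0 : 0 < 2^-1 - t by apply: lt_trans s0; rewrite invr_gt0.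
  have -> : c + 2^-1 *: w + (v + t *: w) =
      (2^-1 - t) *: (c + (2^-1 - t)^-1 *: v) + (1 - (2^-1 - t)) *: y.
    have yE : y = c + w by rewrite /w addrC subrK.
    rewrite yE [X in _ = X + _]scalerDr scalerA divff ?gt_eqF // scale1r.
    rewrite [X in _ = _ + X]scalerDr [RHS]addrACA -[X in _ = X + _]scalerDl.
    rewrite (_ : 2^-1 - t + (1 - (2^-1 - t)) = 1); last by ring.
    rewrite scale1r addrACA -scalerDl addrA; congr (_ + _ *: _).
    by field.
  move/convex_setP: cC; apply => //.
    by rewrite ltW //=; lra.
  apply: Hr; first exact: VZ.
  rewrite normrZ gtr0_norm ?invr_gt0 // mulrC ltr_pdivrMr //.
  by apply: lt_trans v_lt _; rewrite ltr_pM2l.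
move=> z; have [v Vv [a ->]] := span z.
(* Subtracting [q] times the expansion of [w] eliminates [e j]. *)
pose q := a j / k j.
exists (v - q *: v0 + q *: w).
  exists (v - q *: v0); last by exists q.
  by apply: closed_subspaceB => //; exact: VZ.
exists (fun l => a (lift j l) - q * k (lift j l)).
rewrite wE scalerDr scaler_sumr -!addrA; congr (_ + _).
rewrite addKr !(bigD1_ord j) //= scalerA /q divfK // -addrA; congr (_ + _).
rewrite -big_split /=; apply: eq_bigr => l _.
by rewrite scalerA scalerBl addrC subrK.
Qed.

Lemma finite_dimensional_solid (C : set Y) : finite_dimensional Y ->
  @convex_set R Y C -> C !=set0 -> solid C.
Proof.
move=> [n [e eP]] cC [c Cc].
apply: (@solid_of_spanning C n e c 1 [set 0]) => //; first exact: closed_subspace0.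
  by move=> v -> _; rewrite addr0.
by move=> y; have [k ->] := eP y; exists 0 => //; exists k; rewrite add0r.
Qed.

End FiniteDimension.

(** * Maximal elements *)

Section Core.
Context (R : realType) (X : topologicalType) (Y : completeNormedModType R).
Context (Q : X -> set Y).

Definition lsc_below (T : X -> set Y) := lsc_correspondence T /\ forall x, T x `<=` Q x.

Definition core (x : X) : set Y := [set y | exists2 T, lsc_below T & T x y].

Lemma core_sub x : core x `<=` Q x.
Proof. by move=> y [T [_ TQ] /TQ]. Qed.

Lemma core_lsc : lsc_correspondence core.
Proof.
apply/lsc_near => x y e [T [lT TQ] Txy] e0.
apply: filterS ((lsc_near T).1 lT x y e Txy e0) => x' [y' Ty' yy'].
by exists y' => //; exists T.
Qed.

(** The pointwise combination of two lower semicontinuous correspondences below [Q] is again one. *)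
Lemma core_convex : convex_valued Q -> convex_valued core.
Proof.
move=> cQ x; apply/convex_setP => a b t t01 [S [lS SQ] Sa] [T [lT TQ] Tb].
exists (fun x => [set y | exists2 p, S x p & exists2 q, T x q & y = t *: p + (1 - t) *: q]).
  split.
    apply/lsc_near => x' _ e [p Sp [q Tq ->]] e0.
    apply: filterS2 ((lsc_near S).1 lS x' p e Sp e0) ((lsc_near T).1 lT x' q e Tq e0).
    move=> z [p' Sp' pp'] [q' Tq' qq']; exists (t *: p' + (1 - t) *: q').
      by exists p' => //; exists q'.
    by rewrite opprD addrACA -!scalerBr; exact: norm_convex_lt.
  move=> x' _ [p /SQ Qp [q /TQ Qq ->]].
  by move/convex_setP: (@cQ x'); apply.
by exists a => //; exists b.
Qed.

End Core.

Section Equilibrium.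
Context (R : realType) (X : topologicalType) (I : eqType) (Y : completeNormedModType R).
Context (A : I -> set Y) (prj : I -> X -> Y) (C : countType) (b : C -> X -> R).
Hypothesis X_compact : compact [set: X].
Hypothesis A_convex : forall i, @convex_set R Y (A i).
Hypothesis prj_continuous : forall i, continuous (prj i).
Hypothesis prj_nbhs : forall G x, open G -> G x -> exists s : seq I, exists2 e : R,
  0 < e & forall x', (forall i, i \in s -> `|prj i x - prj i x'| < e) -> G x'.
Hypothesis prj_in : forall i x, A i (prj i x).
Hypothesis prj_surj : forall y, (forall i, A i (y i)) -> exists x, forall i, prj i x = y i.
Hypothesis b_base : bump_base b.
Hypothesis Y_separable : separable Y.
Hypothesis A_compact : forall i, compact (A i).
Context (Q : I -> X -> set Y).
Hypothesis Q_sub : forall i x, Q i x `<=` A i.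
Hypothesis Q_convex : forall i, convex_valued (Q i).
Hypothesis Q_irrefl : forall i x, ~ Q i x (prj i x).
Hypothesis Q_lsc : forall i x, Q i x !=set0 -> exists2 T, lsc_below (Q i) T & T x !=set0.
Hypothesis Q_solid : forall i, finite_dimensional Y \/
  forall x, Q i x !=set0 -> exists2 T, lsc_below (Q i) T & (T x)° !=set0.

(** In the second case, an interior point of a single [T x] is interior to the union
    [core (Q i) x]. *)
Lemma solid_core i x : core (Q i) x !=set0 -> solid (core (Q i) x).
Proof.
move=> C0; have [fdY|KK] := Q_solid i.
  by apply: finite_dimensional_solid => //; apply: core_convex; exact: Q_convex.
have [|T [lT TQ] [y yT]] := KK x.
  by have [y /core_sub Qy] := C0; exists y.
apply: solid_interior; exists y; apply: filterS yT => z Tz.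
by exists T.
Qed.

Lemma exists_maximal : X -> exists x, forall i, ~ (Q i x !=set0).
Proof.
move=> x0; apply: contrapT => noeq.
have /choice[i iP] : forall x, exists i, core (Q i) x !=set0.
  move=> x; apply: contrapT => /forallNP H; apply: noeq; exists x => i.
  by move=> /Q_lsc[T TQ [y Ty]]; apply: (H i); exists y; exists T.
have oG x : open [set x' | core (Q (i x)) x' !=set0].
  have := @core_lsc _ _ _ (Q (i x)) setT openT.
  by under eq_set do rewrite setIT.
have [n [z [w [[wC w0 w1] wG]]]] := partition_of_unity X_compact b_base oG iP.
(* The weights of one player are added up. One of the [n] weights is at least [1/n], so the closed
   sets [K j] still cover, and positive mass of [j] means that [core (Q j) x] is nonempty. *)
pose mass j x := \sum_(k < n | i (z k) == j) w k x.
pose K j := [set x | n%:R^-1 <= mass j x].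
have n0 : (0 < n)%N.
  case: n z w wC w0 w1 {wG mass K} => // z w _ _ /(_ x0); rewrite big_ord0 => /eqP.
  by rewrite eq_sym oner_eq0.
have K_closed j : closed (K j).
  apply: (@preimage_closed _ _ (mass j) [set t | n%:R^-1 <= t]); last exact: closed_ge.
  move=> x _; apply: continuous_sum => k ?.
  exact: wC.
have K_core j x : K j x -> core (Q j) x !=set0.
  move=> Kx; apply: contrapT => nC; suff m0 : mass j x = 0.
    by move: Kx; rewrite /K /= m0 leNgt invr_gt0 ltr0n n0.
  apply: big1 => k /eqP ij; apply/eqP; apply: contrapT => /negP wk; apply: nC.
  by rewrite -ij; apply: wG; rewrite lt_def wk w0.
have K_cover x : exists k, K (i (z k)) x.
  apply: contrapT => /forallNP H; suff : \sum_k w k x < 1 by rewrite w1 ltxx.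
  have -> : 1 = \sum_(k < n) n%:R^-1 :> R.
    by rewrite sumr_const card_ord -(mulr_natl n%:R^-1) divff // pnatr_eq0 -lt0n.
  apply: ltr_sum => [|k _]; first by apply/hasP; exists (Ordinal n0); rewrite ?mem_index_enum.
  rewrite ltNge; apply/negP => wk; apply: (H k); apply: le_trans wk _.
  by rewrite /mass (bigD1 k) //= lerDl sumr_ge0.
have A_closed j : closed (A j) by apply: compact_closed; [exact: norm_hausdorff|exact: A_compact].
(* Off [K j] every strategy is allowed. This extends the core from [K j] to all profiles, and it
   stays lower semicontinuous because [K j] is closed. *)
pose Phi j x := [set y | A j y /\ (K j x -> core (Q j) x y)].
have selection j : exists2 f : X -> Y, continuous f &
    forall x, A j (f x) /\ (K j x -> core (Q j) x (f x)).
  have [M [_ MP]] := compact_bounded (@A_compact j).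
  have [||x|x|f fC fP] := solid_selection (Phi := Phi j) (M := M + 1) X_compact b_base Y_separable.
  - apply/lsc_near => x y e [Ay Ky] e0; have [Kx|nKx] := pselect (K j x).
      have := (lsc_near _).1 (@core_lsc _ _ _ (Q j)) x y e (Ky Kx) e0.
      apply: filterS => x' [y' Cy' yy']; exists y' => //; split=> //.
      exact: Q_sub (core_sub Cy').
    have nK : \forall x' \near x, ~ K j x'.
      by apply: (open_nbhs_nbhs (A := ~` K j)); split=> //; exact: closed_openC.
    by apply: filterS nK => x' nK'; exists y; [split|rewrite subrr normr0].
  - move=> x; apply/convex_setP => p q t t01 [Ap Kp] [Aq Kq]; split.
      by move/convex_setP: (@A_convex j); apply.
    move=> Kx; have /convex_setP := @core_convex _ _ _ (Q j) (Q_convex (i := j)) x; apply => //.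
      exact: Kp.
    exact: Kq.
  - have [Kx|nKx] := pselect (K j x).
      by have [y Cy] := K_core _ _ Kx; exists y; split=> //; exact: Q_sub (core_sub Cy).
    by exists (prj j x); split.
  - by move=> y [Ay _]; apply: (MP (M + 1)) => //; rewrite ltrDl.
  exists f => // x; have [clf Sf] := fP x; split.
    by rewrite ((closure_id (A j)).1 (A_closed j)); apply: closure_subset clf => y [].
  move=> Kx; have PhiE : Phi j x = core (Q j) x.
    apply/seteqP; split=> [y [_ /(_ Kx)]//|y Cy]; split=> //; exact: Q_sub (core_sub Cy).
  by rewrite -PhiE; apply: Sf; rewrite PhiE; apply/solid_core/K_core.
have /choice[f fP] : forall j, exists f : X -> Y, continuous f /\
    forall x, A j (f x) /\ (K j x -> core (Q j) x (f x)).
  by move=> j; have [f] := selection j; exists f.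
(* It is enough to fix the coordinates of the finitely many players in the cover. *)
have [||x xP] := product_fixed_point X_compact A_convex prj_continuous prj_nbhs prj_in prj_surj
   b_base (f := f) [seq i (z k) | k <- enum 'I_n] x0.
- by move=> j; exact: (fP j).1.
- by move=> j x; exact: ((fP j).2 x).1.
have [k Kx] := K_cover x; apply: (@Q_irrefl (i (z k)) x); apply: core_sub.
rewrite xP; first exact: ((fP _).2 x).2.
by apply/mapP; exists k; rewrite ?mem_enum.
Qed.

End Equilibrium.

(** * Games with a common partition *)

Lemma compact_set_type (T : topologicalType) (A : set T) :
  compact A -> compact [set: set_type A].
Proof.
move=> cA F FF _; have FA : F (set_val @^-1` A) by apply: filterE => x; exact: set_valP.
have [y [Ay cly]] := cA (set_val @ F) (fmap_proper_filter _ FF) FA.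
exists (exist _ y (mem_set Ay)); split=> // B N FB [_ [[V oV <-] /= Vy VN]].
have FB' : F (set_val @^-1` (set_val @` B)) by apply: filterS FB => b Bb; exists b.
have [_ [[b Bb <-] Vb]] := cly _ V FB' (open_nbhs_nbhs (conj oV Vy)).
by exists b; split=> //; exact: VN.
Qed.

(** * The compact space of profiles *)

Section Profile.
Context (R : realType) (I : countType) (Y : completeNormedModType R) (A : I -> set Y).

Definition coord (i : I) (x : profile A) : Y := set_val (x i).

Lemma compact_profile : (forall i, compact (A i)) -> compact [set: profile A].
Proof.
move=> cA; have := @tychonoff I (fun i => set_type (A i)) (fun i => setT)
  (fun i => compact_set_type (cA i)).
by congr (@compact (profile A) _); apply/seteqP; split.
Qed.

Lemma coord_cvg (i : I) : continuous (coord i).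
Proof.
move=> x; apply: (@continuous_comp _ _ _ (fun x : profile A => x i) set_val).
  exact: (@proj_continuous I (fun i => set_type (A i)) i x).
exact: initial_continuous.
Qed.

(** The sets constrained in finitely many coordinates generate a filter that converges to [x] in
    each coordinate, hence in the product topology. *)
Lemma coord_nbhs (G : set (profile A)) x : open G -> G x ->
  exists s : seq I, exists2 e : R, 0 < e &
    forall x', (forall i, i \in s -> `|coord i x - coord i x'| < e) -> G x'.
Proof.
move=> oG Gx.
pose F := filter_from [set se : seq I * R | 0 < se.2]
  (fun se => [set x' | forall i, i \in se.1 -> `|coord i x - coord i x'| < se.2]).
have FF : Filter F.
  apply: filter_from_filter; first by exists ([::], 1) => /=.
  move=> [s e] [s' e'] /= e0 e'0; exists (s ++ s', Num.min e e') => /=.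
    by rewrite lt_min e0.
  move=> x' H; split=> i si; have := H i; rewrite mem_cat si ?orbT => /(_ isT);
    by rewrite lt_min => /andP[].
have Fx : F --> x.
  apply/cvg_sup => i N [_ [[_ [W oW <-] <-] /= Wx WN]].
  rewrite nbhs_simpl; have /nbhs_ballP[e /= e0 eW] := open_nbhs_nbhs (conj oW Wx).
  exists ([:: i], e) => //= x' /(_ i (mem_head _ _)) xx'.
  by apply: WN; apply: eW; rewrite -ball_normE.
have [[s e] /= e0 sG] := Fx G (open_nbhs_nbhs (conj oG Gx)).
by exists s, e.
Qed.

Lemma coord_in i x : A i (coord i x).
Proof. exact: set_valP. Qed.

Lemma coord_surj (y : I -> Y) : (forall i, A i (y i)) -> exists x, forall i, coord i x = y i.
Proof. by move=> Ay; exists (fun i => exist _ (y i) (mem_set (Ay i))). Qed.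

(** An index lists finitely many players, each with a point of a dense sequence, and a radius. The
    function is the radius minus the sum of the distances, so where it is positive all listed
    coordinates are close to their points. *)
Lemma profile_bump_base : separable Y ->
  exists b : seq (I * nat) * nat -> profile A -> R, bump_base b.
Proof.
move=> /separable_sequence[a aP].
exists (fun c x => c.2.+1%:R^-1 - \sum_(p <- c.1) `|coord p.1 x - a p.2|); split.
  move=> c; suff sC : continuous (fun x => \sum_(p <- c.1) `|coord p.1 x - a p.2|).
    by move=> x; exact: cvgB (cvg_cst _) (sC x).
  move=> x; apply: (@cvg_big _ _ _ _ _ add_continuous _ (nbhs x) _ _ _ (nbhs_filter x)) => p _.
  by apply: cvg_norm; apply: cvgB; [exact: coord_cvg|exact: cvg_cst].
move=> G x oG Gx; have [s [e e0 sG]] := coord_nbhs oG Gx.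
have [m Hm] := natinv_lt (divr_gt0 e0 (ltr0Sn R 1)).
have d0 : 0 < m.+1%:R^-1 / (size s).+1%:R :> R by rewrite divr_gt0 ?invr_gt0 ?ltr0Sn.
have /choice[k kP] : forall i, exists n, `|a n - coord i x| < m.+1%:R^-1 / (size s).+1%:R.
  by move=> i; exact: aP.
have sum_map x' : \sum_(p <- [seq (i, k i) | i <- s]) `|coord p.1 x' - a p.2| =
    \sum_(i <- s) `|coord i x' - a (k i)| by rewrite big_map.
have x_lt : \sum_(i <- s) `|coord i x - a (k i)| < m.+1%:R^-1.
  apply: (@le_lt_trans _ _ (\sum_(i <- s) m.+1%:R^-1 / (size s).+1%:R)).
    by apply: ler_sum => i _; rewrite distrC; exact/ltW/kP.
  rewrite big_const_seq count_predT iter_addr_0 -(mulr_natr (m.+1%:R^-1 / _)).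
  by rewrite -mulrA gtr_pMr ?invr_gt0 ?ltr0Sn // mulrC ltr_pdivrMr ?ltr0Sn // mul1r ltr_nat.
exists ([seq (i, k i) | i <- s], m); rewrite ?sum_map ?subr_gt0 // => x'.
rewrite sum_map subr_gt0 => x'_lt; apply: sG => i si.
have near_coord z : \sum_(i <- s) `|coord i z - a (k i)| < m.+1%:R^-1 ->
    `|coord i z - a (k i)| < e / 2.
  move=> z_lt; apply: lt_trans Hm; apply: le_lt_trans z_lt.
  by rewrite (big_rem i) //= lerDl; apply: sumr_ge0.
rewrite -(subrKA (a (k i))); apply: le_lt_trans (ler_normD _ _) _.
rewrite [X in _ + X]distrC [ltRHS]splitr; apply: ltrD; exact: near_coord.
Qed.

End Profile.

(** * Equilibrium at a fixed state *)

Section StaticEquilibrium.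
Context (d : measure_display) (Omega : measurableType d) (R : realType).
Context (I : countType) (Y : completeNormedModType R) (A : I -> set Y).
Context (h : I -> Omega -> profile A -> R) (w : Omega).
Hypothesis A_convex : forall i, @convex_set R Y (A i).
Hypothesis h_concave : forall i (x : profile A), concave_on (fun y : A i => h i w (dfwith x i y)).

Lemma dfwith_id (x : profile A) i : dfwith x i (x i) = x.
Proof. by apply: functional_extensionality_dep => j; case: dfwithP. Qed.

Lemma improvement_convex i : convex_valued (improvement i (h i) w).
Proof.
move=> x; apply/convex_setP => _ _ t t01 [a /= ha <-] [b /= hb <-].
have Ac : A i (t *: set_val a + (1 - t) *: set_val b).
  by move/convex_setP: (@A_convex i); apply => //; exact: set_valP.
pose c : A i := exist (fun y => y \in A i) _ (mem_set Ac).
exists c => //=; rewrite subr_gt0; rewrite !subr_gt0 in ha hb.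
have hc := @h_concave i x t a b c t01 erefl; apply: lt_le_trans hc.
have /andP[t0 t1] := t01.
have [t_eq0|t_neq0] := eqVneq t 0; first by rewrite t_eq0 mul0r add0r subr0 mul1r.
have tp : 0 < t by rewrite lt_def t_neq0.
have -> : h i w x = t * h i w x + (1 - t) * h i w x by ring.
by apply: ltr_leD; [rewrite ltr_pM2l|rewrite ler_wpM2l ?subr_ge0 // ltW].
Qed.

Lemma improvement_sub i x : improvement i (h i) w x `<=` A i.
Proof. by move=> _ [a _ <-]; exact: set_valP. Qed.

Lemma improvement_irrefl i x : ~ improvement i (h i) w x (coord i x).
Proof.
move=> [a /= ha e]; suff ax : a = x i by move: ha; rewrite ax dfwith_id subrr ltxx.
exact: val_inj.
Qed.

(** A correspondence that is lower semicontinuous on an open set remains so when extended by empty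
    values. Its hulls stay among the improvements because these form a convex set. *)
Lemma inclusion_lsc_below i (F : profile A -> Omega -> profile A -> set Y)
    (O : profile A -> Omega -> set (profile A)) z :
  continuous_inclusion (improvement i (h i)) F O ->
  dom (improvement i (h i)) (w, z) ->
  lsc_below (improvement i (h i) w)
    (fun x => [set y | O z w x /\ con (F z w x) y]).
Proof.
move=> /(_ z)[/(_ w) H /(_ w) lF _] dz; have [oO Oz Fsub] := H dz; split.
  move=> V oV; have [W oW WE] := lF dz V oV.
  rewrite (_ : [set x | _] = W `&` O z w); first exact: openI.
  apply/seteqP; split=> [x [y [[Ox Fy] Vy]]|x [Wx Ox]].
    split=> //; have : [set x' : O z w | con (F z w (set_val x')) `&` V !=set0]
        (exist _ x (mem_set Ox)) by exists y.
    by rewrite -WE.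
  have : (set_val @^-1` W) (exist _ x (mem_set Ox) : O z w) by [].
  by rewrite WE => -[y [Fy Vy]]; exists y.
move=> x y [/Fsub[_ FQ]]; apply: smallest_sub FQ _; exact: improvement_convex.
Qed.

Lemma static_equilibrium (F : I -> profile A -> Omega -> profile A -> set Y)
    (O : I -> profile A -> Omega -> set (profile A)) :
  separable Y -> (forall i, A i !=set0) -> (forall i, compact (A i)) ->
  (forall i, continuous_inclusion (improvement i (h i)) (F i) (O i)) ->
  (forall i, finite_dimensional Y \/ forall x, dom (improvement i (h i)) (w, x) ->
     KK (improvement i (h i)) (F i) (O i) w x !=set0) ->
  exists x, forall i, is_max [set h i w (dfwith x i y) | y in [set: A i]] (h i w x).
Proof.
move=> sepY A0 cA incl KKne.
have [b bB] := profile_bump_base A sepY.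
have x0 : profile A by move=> i; have [y Ay] := cid (A0 i); exact: (exist _ y (mem_set Ay)).
have [|||x xP] := exists_maximal (compact_profile cA) A_convex (@coord_cvg _ _ _ A)
  (@coord_nbhs _ _ _ A) (@coord_in _ _ _ A) (@coord_surj _ _ _ A) bB sepY cA
  (Q := fun i => improvement i (h i) w) (@improvement_sub) improvement_convex
  improvement_irrefl.
- move=> i x Qx; exists (fun x' => [set y | O i x w x' /\ con (F i x w x') y]).
    exact: inclusion_lsc_below (incl i) Qx.
  have [/(_ w)/(_ Qx)[_ Ox /(_ x Ox)[[y Fy] _]] _ _] := incl i x.
  by exists y; split=> //; exact: sub_gen_smallest.
- move=> i; have [|KKi] := KKne i; first by left.
  (* The interior point comes from the witness at another profile [z], whose neighbourhood contains
     [x]. *)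
  right=> x /(KKi x)[y [z [Ozx Qz] yF]].
  exists (fun x' => [set y | O i z w x' /\ con (F i z w x') y]).
    exact: inclusion_lsc_below (incl i) Qz.
  exists y; apply: filterS yF => v Fv; split=> //; exact: sub_gen_smallest.
- exact: x0.
exists x => i; split; first by exists (x i); rewrite ?dfwith_id.
move=> _ [y _ <-]; rewrite leNgt; apply/negP => xy; apply: (xP i).
by exists (set_val y); exists y; rewrite //= subr_gt0.
Qed.

End StaticEquilibrium.

(** * Countable partitions and conditional utilities *)

Section CommonPartition.
Context (d : measure_display) (T : measurableType d) (R : realType).

Lemma mem_cell (P : set (set T)) w : partition P id setT -> P (cell P w) /\ cell P w w.
Proof.
move=> [cP _ _]; have [E PE Ew] : cover P id w by rewrite cP.
by have := @getPex _ [set E | P E /\ id E w] (ex_intro _ E (conj PE Ew)).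
Qed.

Lemma cell_eq (P : set (set T)) w E : partition P id setT -> P E -> E w -> cell P w = E.
Proof.
move=> pP PE Ew; have [Pc cw] := mem_cell w pP; have [_ tP _] := pP.
by apply: (tP _ _ Pc PE); exists w.
Qed.

(** For each [n] only finitely many cells have measure above [1/(n+1)], since [n+1] disjoint ones
    would have total measure above one. *)
Lemma countable_positive_partition (mu : probability T R) (P : set (set T)) :
  trivIset P id -> P `<=` measurable -> (forall E, P E -> (0 < mu E)%E) -> countable P.
Proof.
move=> tP mP P0.
rewrite (_ : P = \bigcup_n [set E | P E /\ n.+1%:R^-1 < fine (mu E)]); last first.
  apply/seteqP; split=> [E PE|E [n _ []//]].
  have /natinv_lt[n Hn] : 0 < fine (mu E).
    by rewrite fine_gt0 // P0 //= ltey_eq fin_num_measure //; exact: mP.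
  by exists n.
apply: bigcup_countable => // n _; apply: finite_set_countable.
apply: contrapT => /infiniteP/pcard_leP/injfunPex[/= q q_fun q_inj].
have qP k : P (q k) by have [] := q_fun k Logic.I.
have mq k : measurable (q k) by exact/mP/qP.
have : (mu (\bigcup_k q k) <= 1)%E by apply: probability_le1; exact: bigcup_measurable.
rewrite leNgt => /negP; apply.
rewrite measure_bigcup //; last first.
  move=> i j _ _ qij; apply: q_inj; rewrite ?inE //; exact: tP (qP i) (qP j) qij.
apply: (@lt_le_trans _ _ (\sum_(0 <= k < n.+1) mu (q k))%E); last first.
  apply: le_trans (nneseries_lim_ge n.+1 _) _ => //.
  by rewrite le_eqVlt; apply/orP; left; apply/eqP; apply: eq_eseriesl => i; rewrite in_setT.
rewrite -EFin_sum_fine; last by move=> k _; rewrite fin_num_measure.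
rewrite lte_fin (_ : 1 = \sum_(0 <= k < n.+1) n.+1%:R^-1 :> R); last first.
  by rewrite sumr_const_nat subn0 -[RHS]mulr_natr mulVf.
by apply: ltr_sum => // k _; have [] := q_fun k Logic.I.
Qed.

Lemma measurable_fun_countable_partition (P : set (set T)) (d' : measure_display)
    (T' : measurableType d') (f : T -> T') (g : set T -> T') :
  partition P id setT -> P `<=` measurable -> countable P ->
  (forall w, f w = g (cell P w)) -> measurable_fun setT f.
Proof.
move=> pP mP /countable_injP[code codeI] fg _ B _; rewrite setTI.
pose G n := [set w | exists E, [/\ P E, code E = n, B (g E) & E w]].
rewrite (_ : f @^-1` B = \bigcup_n G n).
  apply: bigcup_measurable => n _.
  have [[E [PE En BE]]|nE] := pselect (exists E, [/\ P E, code E = n & B (g E)]).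
    rewrite (_ : G n = E); first exact: mP.
    apply/seteqP; split=> [w [E' [PE' En' _ Ew]]|w Ew]; last by exists E.
    by rewrite (codeI E E') ?inE // En En'.
  rewrite (_ : G n = set0) //; apply/seteqP; split=> // w [E [PE En BE _]].
  by apply: nE; exists E.
apply/seteqP; split=> [w Bw|w [n _ [E [PE _ BE Ew]]]].
  have [Pc cw] := mem_cell w pP; exists (code (cell P w)) => //.
  by exists (cell P w); split=> //; rewrite -fg.
by rewrite /= fg (cell_eq pP PE Ew).
Qed.

Lemma cond_utility_cell (mu : probability T R) (I : countType) (Y : completeNormedModType R)
    (A : I -> set Y) (q : T -> R) (P : set (set T)) (u : T -> profile A -> R) w w' :
  cell P w = cell P w' -> cond_utility mu q P u w = cond_utility mu q P u w'.
Proof. by move=> ww'; apply/funext => x; rewrite /cond_utility /posterior ww'. Qed.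

Lemma cond_utility_concave (mu : probability T R) (I : countType) (Y : completeNormedModType R)
    (A : I -> set Y) (q : T -> R) (P : set (set T)) (u : T -> profile A -> R) w i
    (x : profile A) :
  measurable_partition P -> (forall t, 0 <= q t) ->
  (forall x, mu.-integrable (cell P w) (fun t => (posterior mu q P w t * u t x)%:E)) ->
  (forall t, concave_on (fun y : A i => u t (dfwith x i y))) ->
  concave_on (fun y : A i => cond_utility mu q P u w (dfwith x i y)).
Proof.
move=> [pP mP] q0 uI uC s a b c s01 cab; have [Pw _] := mem_cell w pP.
have mw : measurable (cell P w) by exact: mP.
have uI' (y : A i) : mu.-integrable (cell P w)
    (EFin \o (fun t => posterior mu q P w t * u t (dfwith x i y))) by exact: uI.
have sI (k : R) (y : A i) : mu.-integrable (cell P w)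
    (EFin \o (fun t => k * (posterior mu q P w t * u t (dfwith x i y)))).
  by have := integrableZl mw k (uI' y); apply: eq_integrable.
rewrite /cond_utility -!RintegralZl // -RintegralD //.
apply: le_Rintegral => //.
  by have := integrableD mw (sI s a) (sI (1 - s) b); apply: eq_integrable.
move=> t wt; rewrite !(mulrCA _ (posterior _ _ _ _ _)) -mulrDr; apply: ler_wpM2l.
  rewrite /posterior; case: ifP => // _; rewrite divr_ge0 //.
  by apply: Rintegral_ge0 => r _; exact: q0.
exact: uC.
Qed.

End CommonPartition.

Theorem theorem6p10 (R : realType)
  (d : measure_display) (Omega : measurableType d) (mu : probability Omega R)
  (mu_complete : measure_is_complete mu)
  (I : countType)
  (Y : completeNormedModType R) (Y_separable : separable Y)
  (A : I -> set Y) (u : I -> Omega -> profile A -> R)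
  (q : I -> Omega -> R) (P : set (set Omega))
  (q_prior : forall i, prior_density mu (q i))
  (P_partition : measurable_partition P)
  (cell_pos : forall i w, 0 < \int[mu]_(t in cell P w) q i t)
  (u_integrable : forall i w x,
     mu.-integrable (cell P w)
       (fun t => (posterior mu (q i) P w t * u i t x)%:E))
  (h : I -> Omega -> profile A -> R)
  (h_def : forall i, h i = cond_utility mu (q i) P (u i))
  (A_nonempty : forall i, A i !=set0)
  (A_compact : forall i, compact (A i))
  (A_convex : forall i, @convex_set R Y (A i))
  (u_concave : forall i w (x : profile A),
     concave_on (fun y : A i => u i w (dfwith x i y)))
  (F : I -> profile A -> Omega -> profile A -> set Y)
  (O : I -> profile A -> Omega -> set (profile A))
  (Q_inclusion : forall i,
     (atomic mu -> continuous_inclusion (improvement i (h i)) (F i) (O i)) /\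
     (~ atomic mu ->
        strong_continuous_inclusion (improvement i (h i)) (F i) (O i)))
  (dim_or_KK : forall i,
     finite_dimensional Y \/
     forall w x, dom (improvement i (h i)) (w, x) ->
       KK (improvement i (h i)) (F i) (O i) w x !=set0) :
  exists x : Omega -> profile A, bayesian_equilibrium mu h x.
Proof.
have [pP mP] := P_partition.
have incl i : continuous_inclusion (improvement i (h i)) (F i) (O i).
  have [Fat Fna] := Q_inclusion i.
  by have [/Fat//|/Fna[]] := pselect (atomic mu).
have q_ge0 i t : 0 <= q i t by have [/(_ t)/andP[/ltW]] := q_prior i.
have h_concave w i (x : profile A) : concave_on (fun y : A i => h i w (dfwith x i y)).
  by rewrite h_def; apply: cond_utility_concave.
have h_cell w w' i : cell P w = cell P w' -> h i w = h i w'.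
  by move=> ww'; rewrite h_def; exact: cond_utility_cell.
have static w : exists x, forall i,
    is_max [set h i w (dfwith x i y) | y in [set: A i]] (h i w x).
  apply: (static_equilibrium A_convex (h_concave w) Y_separable A_nonempty A_compact incl).
  by move=> i; have [|KKi] := dim_or_KK i; [left|right=> x; exact: KKi].
(* One profile is chosen per cell, not per state, so that the strategies are constant on cells. Sets
   that are not cells receive an arbitrary profile. *)
have /choice[X XP] : forall E, exists x, forall w, cell P w = E -> forall i,
    is_max [set h i w (dfwith x i y) | y in [set: A i]] (h i w x).
  move=> E; have [[w wE]|nE] := pselect (exists w, cell P w = E).
    have [x xP] := static w; exists x => w' w'E i.
    by rewrite (h_cell w' w i) ?w'E.
  exists (fun i => exist (fun y => y \in A i) _ (mem_set (projT2 (cid (A_nonempty i))))) => w wE.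
  by case: nE; exists w.
exists (fun w => X (cell P w)); split=> [i|i]; last by apply: aeW => w; exact: XP.
have [_ tP neP] := pP.
apply: (@measurable_fun_countable_partition _ _ P _ (g_sigma_algebraType (@open Y)) _
  (fun E => set_val (X E i))) => //.
apply: (countable_positive_partition (mu := mu)) => // E PE.
have [w Ew] := neP E PE; rewrite -(cell_eq pP PE Ew) lt0e measure_ge0 andbT.
have mc : measurable (cell P w) by rewrite (cell_eq pP PE Ew); exact: mP.
(* On a null cell the prior density would integrate to zero. *)
apply/eqP => mu0; have := cell_pos i w; rewrite /Rintegral null_set_integral ?ltxx //.
by have [_ mq _] := q_prior i; apply/measurable_EFinP; exact: measurable_funTS.
Qed.
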